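(* For every positive integer $n$, $$\sum_{w\in\max(F_{n+1})} q^{\mathrm{inv}_R(w)}=q^{\binom n2}\,C_n(q^{-1}),$$ or equivalently $$\sum_{w\in\max(F_{n+1})} q^{\mathrm{inv}_{LN}(w)}=C_n(q),$$ where $C_n(q)$ is the Carlitz–Riordan $q$-Catalan number.
   Context: For a positive integer $m$: $S_m$ is the symmetric group on $\{1,\dots,m\}$, with product $(\pi\sigma)(i)=\pi(\sigma(i))$; $(a,b)$ denotes a transposition. Let $c=(1,2,\dots,m)$. $F_m$ is the set of maximal chains in the lattice $NC(m)$ of non-crossing partitions, identified with the set of words $(t_1,\dots,t_{m-1})$ of transpositions in $S_m$ with $t_1t_2\cdots t_{m-1}=c$. For $1\le i\le m-2$ and $v=(t_1,\dots,t_{m-1})\in F_m$, $R_i(v)$ is obtained from $v$ by replacing $(t_i,t_{i+1})$ by $(t_{i+1}^{t_i},t_i)$, and $L_i(v)$ by replacing $(t_i,t_{i+1})$ by $(t_{i+1},t_i^{t_{i+1}})$, where $g^h=h^{-1}gh$. The Hurwitz graph $G_T(m)$ is the undirected graph on $F_m$ in which distinct $u,v$ are adjacent iff $v=R_i(u)$ or $v=L_i(u)$ for some $i$. It is connected. Put $e=((1,2),(2,3),\dots,(m-1,m))$. The poset $\mathrm{Weak}(F_m)$ is $F_m$ with: $u\le v$ iff $u$ lies on a geodesic in $G_T(m)$ from $e$ to $v$. $\max(F_m)$ is the set of maximal elements of $\mathrm{Weak}(F_m)$. Map $\phi:F_m\to S_{m-1}$: for $w=(t_1,\dots,t_{m-1})\in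 F_m$ let $\sigma_j=t_jt_{j+1}\cdots t_{m-1}$ ($1\le j\le m-1$) and $\sigma_m=id$. For each $1\le j\le m-1$ there is exactly one $i\in\{1,\dots,m-1\}$ with $\sigma_j(i)>\sigma_{j+1}(i)$; set $\phi(w)(j)=i$. This gives a permutation $\phi(w)\in S_{m-1}$. Inversions of $w=(t_1,\dots,t_{m-1})\in F_m$: $\mathrm{Inv}(w)=\mathrm{Inv}(\phi(w))$, where $\mathrm{Inv}(\pi)=\{(i,j): i<j,\ \pi^{-1}(i)>\pi^{-1}(j)\}$. For $(i,j)\in\mathrm{Inv}(w)$ write $x=t_{\phi(w)^{-1}(j)}$ and $y=t_{\phi(w)^{-1}(i)}$. The pair $(i,j)$ is a right inversion if $x=(a,c),y=(a,b)$ for some $a<b<c$, or $x=(a,d),y=(b,c)$ for some $a<b<c<d$; a left inversion if $x=(b,c),y=(a,c)$ for some $a<b<c$, or $x=(b,c),y=(a,d)$ for some $a<b<c<d$; a neutral inversion if $x=(c,d),y=(a,b)$ for some $a<b<c<d$. The sets of right, left and neutral inversions are $\mathrm{Inv}_R(w),\mathrm{Inv}_L(w),\mathrm{Inv}_N(w)$; $\mathrm{Inv}(w)$ is their disjoint union. $\mathrm{inv}_R(w)=|\mathrm{Inv}_R(w)|$ and $\mathrm{inv}_{LN}(w)=|\mathrm{Inv}_L(w)\cup\mathrm{Inv}_N(w)|$. The polynomials $C_n(q)$ are defined by $C_0(q)=1$ and $C_{n+1}(q)=\sum_{k=0}^n q^{(k+1)(n-k)}C_k(q)C_{n-k}(q)$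 for $n\ge 0$. *)

(* Defs.v *)
From HB Require Import structures.
From mathcomp Require Import all_boot all_order all_fingroup all_algebra.
From mathcomp Require Import boolp.

Set Implicit Arguments.
Unset Strict Implicit.
Unset Printing Implicit Defensive.

Import GroupScope.

(* The symmetric group on {1, ..., n + 1} is 'S_n.+1, the point i being
   represented by the ordinal i - 1. *)

(* Products are read from right to left, unlike MathComp's s * t, which
   applies s first. *)
Definition compp (m : nat) (s t : 'S_m) : 'S_m := t * s.

Lemma comppE m (s t : 'S_m) i : compp s t i = s (t i).
Proof. exact: permM. Qed.

Definition prodp (m : nat) (w : seq 'S_m) : 'S_m := foldr (@compp m) 1 w.

Definition conjp (m : nat) (g h : 'S_m) : 'S_m := compp (compp h^-1 g) h.

Definition is_transposition (m : nat) (t : 'S_m) : bool :=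
  [exists a : 'I_m, exists b : 'I_m, (a < b)%N && (t == tperm a b)].

Definition long_cycle (n : nat) : 'S_n.+1 := perm (@ordS_inj n.+1).

Notation word n := (n.-tuple 'S_n.+1).

(* F n is the set written F_{n+1} in the literature: maximal chains of
   NC(n + 1), identified with factorizations of the long cycle. *)
Definition F (n : nat) : {set word n} :=
  [set w : word n |
     all (@is_transposition n.+1) w && (prodp w == long_cycle n)].

(* The moves R_i and L_i; they are only used when i.+1 < size w. *)
Definition hurwitzR (m i : nat) (w : seq 'S_m) : seq 'S_m :=
  let t := nth 1 w i in let t' := nth 1 w i.+1 in
  set_nth 1 (set_nth 1 w i (conjp t' t)) i.+1 t.

Definition hurwitzL (m i : nat) (w : seq 'S_m) : seq 'S_m :=
  let t := nth 1 w i in let t' := nth 1 w i.+1 in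
  set_nth 1 (set_nth 1 w i t') i.+1 (conjp t t').

Definition hurwitz_adj (n : nat) : rel (word n) := fun u v =>
  [&& u \in F n, v \in F n, u != v &
    [exists i : 'I_n.-1, (val v == hurwitzR i u) || (val v == hurwitzL i u)]].

(* p lists the vertices of the path after its origin u, so that size p is the
   number of edges. *)
Definition geodesic (n : nat) (u v : word n) (p : seq (word n)) : Prop :=
  [/\ path (@hurwitz_adj n) u p, last u p = v &
      forall q : seq (word n),
        path (@hurwitz_adj n) u q -> last u q = v -> (size p <= size q)%N].

Definition e_word (n : nat) : word n :=
  [tuple tperm (widen_ord (leqnSn n) k) (lift ord0 k) | k < n].

Definition weak_le (n : nat) (u v : word n) : Prop :=
  exists2 p, geodesic (e_word n) v p & u \in e_word n :: p.

Definition maxF (n : nat) : {set word n} :=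
  [set w in F n | `[< forall v, v \in F n -> weak_le w v -> v = w >]].

(* With ordinals, suffix_prod w j is sigma_{j+1}. *)
Definition suffix_prod (n : nat) (w : word n) (j : nat) : 'S_n.+1 :=
  prodp (drop j w).

Definition raised (n : nat) (w : word n) (j i : 'I_n) : bool :=
  let i' := widen_ord (leqnSn n) i in
  (suffix_prod w j.+1 i' < suffix_prod w j i')%N.

Definition phi_fun (n : nat) (w : word n) : {ffun 'I_n -> 'I_n} :=
  [ffun j => odflt j [pick i | raised w j i]].

(* The default values in phi_fun and phi are irrelevant on F n: see phiP. *)
Definition phi (n : nat) (w : word n) : 'S_n := insubd (1 : 'S_n) (phi_fun w).

Lemma suffix_prodS n (w : word n) (j : 'I_n) :
  suffix_prod w j = compp (tnth w j) (suffix_prod w j.+1).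
Proof.
rewrite /suffix_prod (drop_nth 1) ?size_tuple //=.
by rewrite (tnth_nth 1).
Qed.

Lemma raised_uniq n (w : word n) j i1 i2 :
  w \in F n -> raised w j i1 -> raised w j i2 -> i1 = i2.
Proof.
rewrite inE => /andP[/allP/(_ _ (mem_tnth j w))].
move=> /existsP[a /existsP[b /andP[ltab /eqP tE]]] _.
rewrite /raised suffix_prodS !comppE tE; set s := suffix_prod _ _.
have up x : (s x < tperm a b (s x))%N -> s x = a.
  case: tpermP => [-> //|->|_ _]; last by rewrite ltnn.
  by move=> ltba; rewrite ltnNge ltnW in ltab.
move=> /up s1 /up s2; apply/val_inj.
by have /perm_inj/(congr1 val) : s (widen_ord (leqnSn n) i1) =
  s (widen_ord (leqnSn n) i2) by rewrite s1 s2.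
Qed.

Lemma raised_ex n (w : word n) i : w \in F n -> exists j, raised w j i.
Proof.
rewrite inE => /andP[_ /eqP wE]; apply/existsP; apply: contraT.
rewrite negb_exists => /forallP nr; set x := widen_ord (leqnSn n) i.
suff H k : (k <= n)%N -> (suffix_prod w (n - k) x <= i)%N.
  have := H n (leqnn n); rewrite subnn /suffix_prod drop0 wE permE /=.
  by rewrite modn_small ?ltnn // ltnS ltn_ord.
elim: k => [|k IH] ltk.
  by rewrite subn0 /suffix_prod drop_oversize ?size_tuple //= perm1.
have lt_nk : (n - k.+1 < n)%N by rewrite ltn_subrL (leq_ltn_trans _ ltk).
have := nr (Ordinal lt_nk); rewrite /raised -leqNgt /= subnSK //.
by move/leq_trans; apply; apply: IH; apply: ltnW.
Qed.

Lemma phiP n (w : word n) j i : w \in F n -> raised w j i = (phi w j == i).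
Proof.
move=> wF; pose f := phi_fun w.
have fE k l : raised w k l -> f k = l.
  rewrite ffunE => rkl; case: pickP => [l' rkl'|/(_ l)]; last by rewrite rkl.
  exact: raised_uniq rkl' rkl.
have [g gP] : exists g : {ffun 'I_n -> 'I_n}, forall l, raised w (g l) l.
  exists [ffun l => odflt l [pick k | raised w k l]] => l.
  rewrite ffunE; case: pickP => //= none.
  by have [k] := raised_ex l wF; rewrite none.
have fg : cancel g f by move=> l; exact/fE/gP.
have gf : cancel f g by apply: canF_sym.
have phiE : phi w =1 f.
  have injf : injectiveb f by apply/injectiveP; apply: can_inj gf.
  by move=> k; rewrite -pvalE -[pval _]/(val _) /phi insubdK.
rewrite phiE; apply/idP/eqP => [/fE //|<-].
by rewrite -{1}(gf j); apply: gP.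
Qed.

Definition Inv_perm (n : nat) (s : 'S_n) : {set 'I_n * 'I_n} :=
  [set ij : 'I_n * 'I_n | (ij.1 < ij.2)%N && (s^-1 ij.2 < s^-1 ij.1)%N].

Definition Inv (n : nat) (w : word n) : {set 'I_n * 'I_n} :=
  Inv_perm (phi w).

Definition right_pair (m : nat) (x y : 'S_m) : bool :=
  [exists a : 'I_m, exists b : 'I_m, exists c : 'I_m,
     [&& (a < b < c)%N, x == tperm a c & y == tperm a b]]
  || [exists a : 'I_m, exists b : 'I_m, exists c : 'I_m, exists d : 'I_m,
     [&& (a < b < c)%N, (c < d)%N, x == tperm a d & y == tperm b c]].

Definition left_pair (m : nat) (x y : 'S_m) : bool :=
  [exists a : 'I_m, exists b : 'I_m, exists c : 'I_m,
     [&& (a < b < c)%N, x == tperm b c & y == tperm a c]]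
  || [exists a : 'I_m, exists b : 'I_m, exists c : 'I_m, exists d : 'I_m,
     [&& (a < b < c)%N, (c < d)%N, x == tperm b c & y == tperm a d]].

Definition neutral_pair (m : nat) (x y : 'S_m) : bool :=
  [exists a : 'I_m, exists b : 'I_m, exists c : 'I_m, exists d : 'I_m,
     [&& (a < b < c)%N, (c < d)%N, x == tperm c d & y == tperm a b]].

Definition Inv_of_kind (n : nat) (kind : rel 'S_n.+1) (w : word n) :
    {set 'I_n * 'I_n} :=
  [set ij in Inv w |
     kind (tnth w ((phi w)^-1 ij.2)) (tnth w ((phi w)^-1 ij.1))].

Definition Inv_R n (w : word n) := Inv_of_kind (@right_pair n.+1) w.
Definition Inv_L n (w : word n) := Inv_of_kind (@left_pair n.+1) w.
Definition Inv_N n (w : word n) := Inv_of_kind (@neutral_pair n.+1) w.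

Definition inv_R (n : nat) (w : word n) : nat := #|Inv_R w|.
Definition inv_LN (n : nat) (w : word n) : nat := #|Inv_L w :|: Inv_N w|.

Local Open Scope ring_scope.

(* carlitz_seq n = [:: C_0; ...; C_n]; the recursion is carlitz0, carlitzS. *)
Fixpoint carlitz_seq (n : nat) : seq {poly int} :=
  if n is n'.+1 then
    let s := carlitz_seq n' in
    rcons s (\sum_(k < n'.+1) 'X^(k.+1 * (n' - k)) * s`_k * s`_(n' - k))
  else [:: 1].

Definition carlitz (n : nat) : {poly int} := (carlitz_seq n)`_n.

Lemma size_carlitz_seq n : size (carlitz_seq n) = n.+1.
Proof. by elim: n => //= n IH; rewrite size_rcons IH. Qed.

Lemma nth_carlitz_seq n k : (k <= n)%N -> (carlitz_seq n)`_k = carlitz k.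
Proof.
elim: n => [|n IH]; first by rewrite leqn0 => /eqP ->.
rewrite leq_eqVlt => /predU1P[-> //|ltkn].
by rewrite /= nth_rcons size_carlitz_seq ltkn IH.
Qed.

Lemma carlitz0 : carlitz 0 = 1.
Proof. by []. Qed.

Lemma carlitzS n :
  carlitz n.+1 =
  \sum_(k < n.+1) 'X^(k.+1 * (n - k)) * carlitz k * carlitz (n - k).
Proof.
rewrite {1}/carlitz /= nth_rcons size_carlitz_seq ltnn eqxx.
apply: eq_bigr => k _.
by rewrite !nth_carlitz_seq ?leq_subr // -ltnS ltn_ord.
Qed.

(* Main.v *)
Require Import Defs.
From HB Require Import structures.
From mathcomp Require Import all_boot all_order all_fingroup all_algebra.
From mathcomp Require Import boolp zify.

Set Implicit Arguments.
Unset Strict Implicit.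
Unset Printing Implicit Defensive.

Import GRing.Theory.

(** The labelling phi turns the weak order into a question about inversions of
    permutations.  An edge of the Hurwitz graph changes a single suffix product,
    hence either keeps the labels or exchanges two adjacent ones
    (hurwitz_adj_phi); conversely any two adjacent labels can be exchanged along
    an edge (hurwitz_swap), and e is the only word whose labels are increasing
    (phi_eq1).  Sorting the labels therefore shows that the distance from e to w
    is the number of inversions of w, and that w is maximal exactly when its
    labels are decreasing (maxFE).

    Words with decreasing labels have a Catalan recursion.  Consider more
    generally the factorizations of the cycle along an increasing sequence
    s1, a, ..., y, z in which the letters, in the order in which they act, raise
    the successive points.  The leftmost letter has to raise y to the last point
    z, so it is some (a z), and removing it cuts the cycle into the cycle along
    a, ..., y and the cycle along s1, z.  The remaining letters form a shortest
    factorization of the product of these two cycles, so none of them mixes the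
    two supports (minimal_closed); and the order of the labels says that the
    letters of the first cycle, w2, stand to the left of those of the second,
    w1.  Thus the word is (a z), w2, w1 with w2 and w1 of the same kind
    (falls_cut), and every such choice is allowed (falls_join).

    The kind of an inversion depends only on how the two intervals spanned by
    the letters lie.  Both (a z) and the letters of w2 begin to the right of
    each letter of w1 and do not cross it, so those pairs are left or neutral;
    (a z) covers the letters of w2 and has the same left end or encloses them,
    so those pairs are right.  Hence the decomposition contributes
    (|w2| + 1) |w1| left or neutral pairs besides those inside w2 and w1, which
    is the exponent in the recursion of the Carlitz-Riordan polynomials
    (fall_words_sum).  Every other pair being right, inv_R and inv_LN add up to
    the binomial coefficient, which turns the second identity into the first. *)

(** * Transpositions and products *)

Lemma comppA m (r s t : 'S_m) : compp (compp r s) t = compp r (compp s t).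
Proof. exact: mulgA. Qed.

Lemma prodp_cat m (u v : seq 'S_m) :
  prodp (u ++ v) = compp (prodp u) (prodp v).
Proof.
elim: u => [|t u IH] /=; first by rewrite /compp mulg1.
by rewrite IH comppA.
Qed.

Lemma transpositionP m (t : 'S_m) :
  reflect (exists a b : 'I_m, a < b /\ t = tperm a b) (is_transposition t).
Proof.
apply: (iffP existsP) => [[a /existsP[b /andP[ab /eqP ->]]]|[a [b [ab ->]]]].
  by exists a, b.
by exists a; apply/existsP; exists b; rewrite ab eqxx.
Qed.

Lemma tperm_up m (a b x : 'I_m) : a < b -> (x < tperm a b x) = (x == a).
Proof.
move=> ab; apply/idP/eqP => [|->]; last by rewrite tpermL.
by case: tpermP => [-> //|->|_ _]; lia.
Qed.

Lemma tperm_lt_eq m (a b c d : 'I_m) :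
  a < b -> c < d -> (tperm a b == tperm c d) = (a == c) && (b == d).
Proof.
move=> ab cd; apply/eqP/andP => [E|[/eqP-> /eqP->]//].
have ac : a = c by apply/eqP; rewrite -(tperm_up a cd) -E tpermL.
by rewrite ac eqxx -(tpermL a b) E ac tpermL.
Qed.

Lemma conjp_tperm m (s : 'S_m) a b :
  conjp (tperm a b) s = tperm (s^-1%g a) (s^-1%g b).
Proof. by rewrite /conjp /compp -tpermJ conjgE invgK. Qed.

Lemma conjp_is_transposition m (s t : 'S_m) :
  is_transposition t -> is_transposition (conjp t s).
Proof.
case/transpositionP => a [b [ab ->]]; apply/transpositionP; rewrite conjp_tperm.
have [lt|gt|/val_inj/perm_inj ba] := ltngtP (s^-1%g a) (s^-1%g b).
- by exists (s^-1%g a), (s^-1%g b).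
- by exists (s^-1%g b), (s^-1%g a); rewrite tpermC.
- by rewrite ba ltnn in ab.
Qed.

(** * Words of F *)

Lemma F_transposition n (w : word n) j :
  w \in F n -> is_transposition (tnth w j).
Proof. by rewrite inE => /andP[/allP + _]; apply; apply: mem_tnth. Qed.

Lemma suffix_prod_full n (w : word n) (i : 'I_n) : w \in F n ->
  suffix_prod w 0 (widen_ord (leqnSn n) i) = i.+1 :> nat.
Proof.
rewrite inE => /andP[_ /eqP wE].
by rewrite /suffix_prod drop0 wE permE /= modn_small // ltnS.
Qed.

(** Only the letter labelled i increases the image of i, so every other letter
    weakly decreases it. *)
Lemma suffix_prod_le n (w : word n) (i : 'I_n) j1 j2 : w \in F n ->
  j1 <= j2 <= n -> (forall k : 'I_n, j1 <= k < j2 -> phi w k != i) ->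
  suffix_prod w j1 (widen_ord (leqnSn n) i)
    <= suffix_prod w j2 (widen_ord (leqnSn n) i).
Proof.
move=> wF; elim: j2 => [|j2 IH] /andP[j12 j2n] nr.
  by move: j12; rewrite leqn0 => /eqP->.
move: j12; rewrite leq_eqVlt ltnS => /predU1P[-> //|j12].
have := nr (Ordinal j2n); rewrite -phiP // /raised j12 ltnSn -leqNgt => /(_ isT).
apply: leq_trans; apply: IH => [|k /andP[? ?]]; first by rewrite j12 ltnW.
by apply: nr; lia.
Qed.

Lemma phi_raised n (w : word n) j : w \in F n -> raised w j (phi w j).
Proof. by move=> wF; rewrite phiP. Qed.

(** Two equal adjacent letters cancel.  The point labelling the one that acts
    first would be raised by no other letter, so its image under the whole
    product could not exceed it, whereas the long cycle moves it up. *)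
Lemma adjacent_neq n (w : word n) i (hi : i.+1 < n) : w \in F n ->
  tnth w (Ordinal hi) != tnth w (Ordinal (ltnW hi)).
Proof.
move=> wF; set k1 := Ordinal hi; set k0 := Ordinal (ltnW hi).
apply/eqP => tt'; set q := phi w k1; set x := widen_ord (leqnSn n) q.
have qP k : phi w k == q -> k = k1 by rewrite (inj_eq perm_inj) => /eqP.
have le1 : suffix_prod w i.+2 x <= x.
  have := @suffix_prod_le _ w q i.+2 n wF; rewrite leqnn hi => /(_ isT).
  rewrite {2}/suffix_prod drop_oversize ?size_tuple //= perm1; apply.
  move=> k /andP[ik _]; apply: contraTneq ik => /eqP/qP->.
  by rewrite ltnn.
have le2 : x.+1 <= suffix_prod w i x.
  rewrite -[x.+1](suffix_prod_full q wF).
  apply: suffix_prod_le => // [|k /andP[_ ki]]; first by lia.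
  by apply: contraTneq ki => /eqP/qP->; rewrite -leqNgt leqnSn.
have E : suffix_prod w i = suffix_prod w i.+2.
  rewrite (suffix_prodS w k0) (suffix_prodS w k1) -tt' -comppA.
  have /transpositionP[a [b [_ ->]]] := F_transposition k1 wF.
  by rewrite /compp tperm2 mulg1.
by move: le2; rewrite E ltnNge le1.
Qed.

(** * Replacing two adjacent letters *)

Lemma split_adjacent n (w : word n) i (hi : i.+1 < n) :
  val w = take i w ++
    [:: tnth w (Ordinal (ltnW hi)), tnth w (Ordinal hi) & drop i.+2 w].
Proof.
rewrite -[LHS](cat_take_drop i) !(tnth_nth 1%g) /=; congr (_ ++ _).
have [h1 h2] : i < size w /\ i.+1 < size w by rewrite size_tuple (ltnW hi).
by rewrite (drop_nth 1%g h1) (drop_nth 1%g h2).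
Qed.

Lemma set_nth_adjacent m (u v : seq 'S_m) s t s' t' :
  set_nth 1%g (set_nth 1%g (u ++ [:: s, t & v]) (size u) s') (size u).+1 t' =
  u ++ [:: s', t' & v].
Proof. by elim: u => //= r u IH; congr cons; apply: IH. Qed.

Lemma hurwitzR_cat m (u v : seq 'S_m) s t :
  hurwitzR (size u) (u ++ [:: s, t & v]) = u ++ [:: conjp t s, s & v].
Proof.
by rewrite /hurwitzR !nth_cat ltnn ltnNge leqnSn /= subnn subSnn set_nth_adjacent.
Qed.

Lemma hurwitzL_cat m (u v : seq 'S_m) s t :
  hurwitzL (size u) (u ++ [:: s, t & v]) = u ++ [:: t, conjp s t & v].
Proof.
by rewrite /hurwitzL !nth_cat ltnn ltnNge leqnSn /= subnn subSnn set_nth_adjacent.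
Qed.

Lemma conjp2 m (s t : 'S_m) : is_transposition t -> conjp (conjp s t) t = s.
Proof.
case/transpositionP => a [b [_ ->]].
rewrite /conjp /compp tpermV -!mulgA tperm2 mulg1.
by rewrite !mulgA tperm2 mul1g.
Qed.

Lemma compp_conjpR m (s t : 'S_m) :
  is_transposition s -> compp (conjp t s) s = compp s t.
Proof.
case/transpositionP => a [b [_ ->]].
by rewrite /conjp /compp tpermV !mulgA tperm2 mul1g.
Qed.

Lemma compp_conjpL m (s t : 'S_m) : compp t (conjp s t) = compp s t.
Proof. by rewrite /conjp /compp -!mulgA mulVg mulg1. Qed.

Lemma hurwitz_adjP n (u v : word n) :
  reflect [/\ u \in F n, v \in F n, u != v & exists i (hi : i.+1 < n),
    let s := tnth u (Ordinal (ltnW hi)) in let t := tnth u (Ordinal hi) in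
    val v = take i u ++ [:: conjp t s, s & drop i.+2 u] \/
    val v = take i u ++ [:: t, conjp s t & drop i.+2 u]] (hurwitz_adj u v).
Proof.
have E i (hi : i.+1 < n) :
    (hurwitzR i u = take i u ++ [:: conjp (tnth u (Ordinal hi))
       (tnth u (Ordinal (ltnW hi))), tnth u (Ordinal (ltnW hi)) & drop i.+2 u]) *
    (hurwitzL i u = take i u ++ [:: tnth u (Ordinal hi), conjp
       (tnth u (Ordinal (ltnW hi))) (tnth u (Ordinal hi)) & drop i.+2 u]).
  have sz : size (take i u) = i.
    by rewrite size_take size_tuple ltnW // ltnW.
  have := hurwitzL_cat (take i u) (drop i.+2 u) (tnth u (Ordinal (ltnW hi)))
    (tnth u (Ordinal hi)).
  have := hurwitzR_cat (take i u) (drop i.+2 u) (tnth u (Ordinal (ltnW hi)))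
    (tnth u (Ordinal hi)).
  by rewrite sz -(split_adjacent u hi).
apply: (iffP and4P) => [[-> -> -> /existsP[i]]|[-> -> -> [i [hi]]]].
  have hi : i.+1 < n by have := ltn_ord i; lia.
  rewrite !(E _ hi) => /orP[/eqP->|/eqP->]; split=> //; exists i, hi;
    by [left | right].
have hi' : i < n.-1 by lia.
move=> H; split=> //; apply/existsP; exists (Ordinal hi').
by rewrite !(E _ hi) /=; case: H => ->; rewrite eqxx ?orbT.
Qed.

Lemma adjacent_tnth n (v : word n) i (hi : i.+1 < n) x y p r :
  size p = i -> val v = p ++ [:: x, y & r] ->
  (tnth v (Ordinal (ltnW hi)) = x) * (tnth v (Ordinal hi) = y).
Proof.
move=> sz vE; rewrite !(tnth_nth 1%g) vE /= !nth_cat sz ltnn subnn.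
by rewrite ltnNge leqnSn subSnn.
Qed.

Lemma hurwitz_adj_sym n : symmetric (@hurwitz_adj n).
Proof.
suff H u v : @hurwitz_adj n u v -> hurwitz_adj v u.
  by move=> u v; apply/idP/idP; apply: H.
case/hurwitz_adjP=> uF vF uv [i [hi /= vE]]; apply/hurwitz_adjP.
split=> //; rewrite 1?eq_sym //; exists i, hi.
have tr k := F_transposition k uF.
have sz : size (take i u) = i by rewrite size_take size_tuple ltnW // ltnW.
have tk p : take i (take i u ++ p) = take i u.
  by rewrite take_cat sz ltnn subnn take0 cats0.
have dr x y p : drop i.+2 (take i u ++ [:: x, y & p]) = p.
  by rewrite drop_cat sz ltnNge ltnW //= -addn2 addKn /= drop0.
case: vE => vE; rewrite !(adjacent_tnth hi sz vE) vE tk dr; [right | left];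
  by rewrite conjp2 // -split_adjacent.
Qed.

Lemma suffix_prod_replace n (w v : word n) i (hi : i.+1 < n) x y j :
  compp x y = compp (tnth w (Ordinal (ltnW hi))) (tnth w (Ordinal hi)) ->
  val v = take i w ++ [:: x, y & drop i.+2 w] ->
  j != i.+1 -> suffix_prod v j = suffix_prod w j.
Proof.
move=> E vE ji; have sz : size (take i w) = i.
  by rewrite size_take size_tuple ltnW // ltnW.
have P r : prodp [:: x, y & r] =
    prodp [:: tnth w (Ordinal (ltnW hi)), tnth w (Ordinal hi) & r].
  by rewrite /= -!comppA E.
rewrite /suffix_prod vE [in RHS](split_adjacent w hi) !drop_cat sz.
case: ltnP => ij; first by rewrite !prodp_cat P.
move: ij ji; rewrite leq_eqVlt => /predU1P[<- _|].
  by rewrite subnn !drop0 P.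
rewrite leq_eqVlt eq_sym => /orP[->//|ij _].
by have -> : j - i = (j - i.+2).+2 by lia.
Qed.

Lemma replace_in_F n (w : word n) i (hi : i.+1 < n) x y : w \in F n ->
  is_transposition x -> is_transposition y ->
  compp x y = compp (tnth w (Ordinal (ltnW hi))) (tnth w (Ordinal hi)) ->
  exists2 v, v \in F n & val v = take i w ++ [:: x, y & drop i.+2 w].
Proof.
move=> wF trx try E.
have szv : size (take i w ++ [:: x, y & drop i.+2 w]) == n.
  rewrite size_cat /= size_drop size_takel size_tuple; last exact/ltnW/ltnW.
  by clear -hi; lia.
exists (Tuple szv) => //.
have pE : prodp (Tuple szv) = prodp w.
  have := @suffix_prod_replace n w (Tuple szv) i hi x y 0 E erefl isT.
  by rewrite /suffix_prod !drop0.
move: (wF); rewrite !inE pE => /andP[al ->]; rewrite andbT.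
move: al; rewrite {1}(split_adjacent w hi) !all_cat /= => /andP[-> /and3P[_ _ ->]].
by rewrite trx try.
Qed.

(** * Edges of the Hurwitz graph and labels *)

Lemma phi_agree_off n (u v : word n) i (j : 'I_n) : u \in F n -> v \in F n ->
  (forall k : nat, k != i.+1 -> suffix_prod v k = suffix_prod u k) ->
  j != i :> nat -> j != i.+1 :> nat -> phi v j = phi u j.
Proof.
move=> uF vF E ji ji1; apply/eqP; rewrite -phiP // /raised !E //.
exact: (phi_raised j uF).
Qed.

Lemma perm_agree_off n (s s' : 'S_n) k0 k1 :
  k0 != k1 -> (forall j, j != k0 -> j != k1 -> s' j = s j) ->
  s' = s \/ s' = (tperm k0 k1 * s)%g.
Proof.
move=> k01 E; pose r := (s' * s^-1)%g.
have rE : perm_on [set k0; k1] r.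
  apply/subsetP => j; rewrite !inE; apply: contraR; rewrite negb_or => /andP[? ?].
  by rewrite permM E // permK.
have : (r k0 == k0) || (r k0 == k1) by have := perm_closed k0 rE; rewrite !inE eqxx.
have s'E : s' = (r * s)%g by rewrite mulgKV.
have rj j : j != k0 -> j != k1 -> r j = j.
  by move=> j0 j1; apply: (out_perm rE); rewrite !inE negb_or j0.
have r1 : r k1 \in [set k0; k1] by rewrite perm_closed // !inE eqxx orbT.
case/orP=> /eqP r0; [left | right]; rewrite s'E.
  suff -> : r = 1%g by rewrite mul1g.
  apply/permP => j; rewrite perm1.
  have [->//|j0] := eqVneq j k0; have [->|j1] := eqVneq j k1; last exact: rj.
  move: r1; rewrite !inE => /orP[]/eqP // r1.
  by case/eqP: k01; apply: (@perm_inj _ r); rewrite r0 r1.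
congr mulg; apply/permP => j; case: tpermP => [->//|->|/eqP j0 /eqP j1].
  move: r1; rewrite !inE => /orP[]/eqP // r1.
  by case/eqP: k01; apply: (@perm_inj _ r); rewrite r0 r1.
exact: rj.
Qed.

(** An edge changes one suffix product only, hence at most two labels; as the
    labels form a permutation, these can at most be exchanged. *)
Lemma hurwitz_adj_phi n (u v : word n) : hurwitz_adj u v ->
  phi v = phi u \/ exists i (hi : i.+1 < n),
    phi v = (tperm (Ordinal (ltnW hi)) (Ordinal hi) * phi u)%g.
Proof.
case/hurwitz_adjP => uF vF uv [i [hi vE]].
have E k : k != i.+1 -> suffix_prod v k = suffix_prod u k.
  have tr j := F_transposition j uF.
  by case: vE => vE; apply: suffix_prod_replace (hi) _ _ _ _ vE;
    rewrite ?compp_conjpR ?compp_conjpL.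
have [||->|->] := @perm_agree_off n (phi u) (phi v) (Ordinal (ltnW hi)) (Ordinal hi).
- by rewrite -val_eqE /= neq_ltn ltnSn.
- move=> j j0 j1; apply: phi_agree_off E _ _; rewrite // -val_eqE in j0 j1 *.
- by left.
- by right; exists i, hi.
Qed.

(** Write the two letters as (a b) and (c d) with a < b and c < d; the second
    acts first.  If a is not moved by (c d), then R_i lets (a b) act first with
    its label unchanged.  If a = c and d < b, then L_i turns (a b) into (d b),
    again with its label unchanged, and lets it act first.  The two letters are
    distinct, and in the remaining configurations w or R_i w would raise the
    same point twice, against the bijectivity of the labelling. *)
Lemma hurwitz_swap n (w : word n) i (hi : i.+1 < n) : w \in F n ->
  exists2 v, hurwitz_adj w v &
    phi v = (tperm (Ordinal (ltnW hi)) (Ordinal hi) * phi w)%g.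
Proof.
set k0 := Ordinal (ltnW hi); set k1 := Ordinal hi => wF.
have k01 : k0 != k1 by rewrite -val_eqE /= neq_ltn ltnSn.
have pq : phi w k0 != phi w k1 by rewrite (inj_eq perm_inj).
have [tr0 tr1] := (F_transposition k0 wF, F_transposition k1 wF).
have [a [b [ab t0E]]] := transpositionP _ tr0.
have [c [d [cd t1E]]] := transpositionP _ tr1.
set st := suffix_prod w i.+2.
pose W := widen_ord (leqnSn n).
have up (v : word n) (vF : v \in F n) (k l : 'I_n) (x y : 'I_n.+1) :
    x < y -> tnth v k = tperm x y ->
    (phi v k == l) = (suffix_prod v k.+1 (W l) == x).
  by move=> xy E; rewrite -phiP // /raised suffix_prodS E comppE tperm_up.
have q_at : st (W (phi w k1)) = c.
  by apply/eqP; rewrite -(up w wF k1 _ _ _ cd t1E) eqxx.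
have p_at : tperm c d (st (W (phi w k0))) = a.
  apply/eqP; rewrite -comppE -t1E -suffix_prodS.
  by rewrite -(up w wF k0 _ _ _ ab t0E) eqxx.
have fin v : v \in F n -> (exists x y, compp x y = compp (tnth w k0) (tnth w k1) /\
    val v = take i w ++ [:: x, y & drop i.+2 w]) -> phi v k1 = phi w k0 ->
    phi v = (tperm k0 k1 * phi w)%g.
  move=> vF [x [y [E vE]]] pv.
  have [|vw|//] := @perm_agree_off n (phi w) (phi v) k0 k1 k01.
    move=> j j0 j1; apply: (@phi_agree_off _ _ _ i j wF vF) => [k||]; try done.
    exact: suffix_prod_replace vE.
  by move: pv; rewrite vw => /perm_inj k10; rewrite k10 eqxx in k01.
have adj v x y : v \in F n -> val v = take i w ++ [:: x, y & drop i.+2 w] ->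
    (x = conjp (tnth w k1) (tnth w k0) /\ y = tnth w k0 \/
     x = tnth w k1 /\ y = conjp (tnth w k0) (tnth w k1)) ->
    phi v = (tperm k0 k1 * phi w)%g -> hurwitz_adj w v.
  move=> vF vE xy pv; apply/hurwitz_adjP; split=> //.
    apply: contraNneq pq => wv; rewrite -wv in pv.
    by rewrite {1}pv permM tpermL.
  by exists i, hi => /=; case: xy vE => -[-> ->]; [left | right].
have sz : size (take i w) = i by rewrite size_take size_tuple ltnW // ltnW.
have cR := compp_conjpR (tnth w k1) tr0; have cL := compp_conjpL (tnth w k0) (tnth w k1).
have [v vF vE] := replace_in_F wF (conjp_is_transposition _ tr1) tr0 cR.
have [v' v'F v'E] := replace_in_F wF tr1 (conjp_is_transposition _ tr0) cL.
have vS k := @suffix_prod_replace _ _ _ i hi _ _ k cR vE.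
have v'S k := @suffix_prod_replace _ _ _ i hi _ _ k cL v'E.
have [v0 v1] := adjacent_tnth hi sz vE; have [v'0 v'1] := adjacent_tnth hi sz v'E.
have ii : i.+2 != i.+1 by rewrite neq_ltn ltnSn orbT.
have usev : phi v k1 = phi w k0 -> exists2 v, hurwitz_adj w v &
    phi v = (tperm k0 k1 * phi w)%g.
  move=> pv; have pE := fin _ vF (ex_intro _ _ (ex_intro _ _ (conj cR vE))) pv.
  by exists v => //; apply: (adj _ _ _ vF vE) pE; left.
have vk1 l : (phi v k1 == l) = (st (W l) == a).
  by rewrite (up v vF k1 l _ _ ab) ?v1 // vS.
have [ac|ac] := eqVneq a c; last first.
  have [ad|ad] := eqVneq a d.
    (* w raises the point at c to d and then to b. *)
    case/negP: pq; apply/eqP/val_inj.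
    have : st (W (phi w k0)) = st (W (phi w k1)).
      by apply: (@perm_inj _ (tperm c d)); rewrite p_at q_at tpermL.
    by move/perm_inj/(congr1 val).
  apply: usev; apply/eqP; rewrite vk1; move: p_at; case: tpermP => [_ /eqP|_ /eqP|_ _ ->//].
    by rewrite eq_sym (negPf ad).
  by rewrite eq_sym (negPf ac).
rewrite -{}ac in cd t1E q_at p_at *.
have bd : b != d.
  by apply: contraNneq (adjacent_neq hi wF) => bd; rewrite t0E t1E bd.
have p_d : st (W (phi w k0)) = d by rewrite -[st _](tpermK a d) p_at tpermL.
have [lt_bd|lt_db|/val_inj bd'] := ltngtP b d; last by rewrite bd' eqxx in bd.
  (* R_i w raises the point at a to b and then to d. *)
  have : phi v k1 = phi v k0.
    transitivity (phi w k1); first by apply/eqP; rewrite vk1 q_at.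
    apply/esym/eqP; have E : tnth v k0 = tperm b d.
      rewrite v0 t0E t1E conjp_tperm tpermV tpermL.
      by rewrite tpermD // neq_ltn ?ab ?cd ?orbT // bd.
    rewrite (up v vF k0 _ _ _ lt_bd E) (suffix_prodS v k1) v1 t0E comppE.
    by rewrite vS // q_at tpermL.
  by move/perm_inj => k10; rewrite k10 eqxx in k01.
have pv : phi v' k1 = phi w k0.
  have E : tnth v' k1 = tperm d b.
    rewrite v'1 t0E t1E conjp_tperm tpermV tpermL.
    by rewrite tpermD // neq_ltn ?ab ?cd ?orbT // lt_db.
  by apply/eqP; rewrite (up v' v'F k1 _ _ _ lt_db E) v'S // p_d.
have pE := fin _ v'F (ex_intro _ _ (ex_intro _ _ (conj cL v'E))) pv.
by exists v' => //; apply: (adj _ _ _ v'F v'E) pE; right.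
Qed.

(** * Inversions of permutations *)

Lemma Inv_perm_swap n (s : 'S_n) i (hi : i.+1 < n) :
  let k0 := Ordinal (ltnW hi) in let k1 := Ordinal hi in
  s k0 < s k1 -> #|Inv_perm (tperm k0 k1 * s)%g| = #|Inv_perm s|.+1.
Proof.
move=> k0 k1 asc.
have -> : Inv_perm (tperm k0 k1 * s)%g = (s k0, s k1) |: Inv_perm s.
  apply/setP => -[x y]; rewrite !inE /= invMg tpermV !permM.
  have -> : ((x, y) == (s k0, s k1)) = (s^-1%g x == k0) && (s^-1%g y == k1).
    by rewrite xpair_eqE !(canF_eq (permKV s)).
  have : x < y -> ~~ ((s^-1%g y == k0) && (s^-1%g x == k1)).
    move=> xy; apply/negP => /andP[/eqP y0 /eqP x1]; move: xy.
    by rewrite -(permKV s x) -(permKV s y) x1 y0 ltnNge (ltnW asc).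
  have : (s^-1%g x == k0) && (s^-1%g y == k1) -> x < y.
    by case/andP=> /eqP x0 /eqP y1; rewrite -(permKV s x) -(permKV s y) x0 y1.
  move: (s^-1%g x) (s^-1%g y) => x' y'; rewrite -!val_eqE /=.
  have T (z : 'I_n) : tperm k0 k1 z =
      (if val z == i then i.+1 else if val z == i.+1 then i else z) :> nat.
    case: tpermP => [->|->|/eqP + /eqP +]; rewrite /= ?eqxx //.
      by case: eqP => // /esym/n_Sn.
    by rewrite -!val_eqE /= => /negPf-> /negPf->.
  rewrite !T; case: (ltnP x y) => /= xy; last lia.
  by do ![case: eqP => ?] => /=; lia.
rewrite cardsU1 inE /= !permK asc /= -leqNgt leqnSn.
by rewrite add1n.
Qed.

Lemma Inv_perm_swap_lt n (s : 'S_n) i (hi : i.+1 < n) :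
  let k0 := Ordinal (ltnW hi) in let k1 := Ordinal hi in
  s k1 < s k0 -> #|Inv_perm s| = #|Inv_perm (tperm k0 k1 * s)%g|.+1.
Proof.
move=> k0 k1 desc; have := @Inv_perm_swap n (tperm k0 k1 * s)%g i hi.
by rewrite /= -/k0 -/k1 mulgA tperm2 mul1g !permM tpermL tpermR; apply.
Qed.

Lemma Inv_perm_swap_le n (s : 'S_n) i (hi : i.+1 < n) :
  #|Inv_perm (tperm (Ordinal (ltnW hi)) (Ordinal hi) * s)%g| <= #|Inv_perm s|.+1.
Proof.
set k0 := Ordinal (ltnW hi); set k1 := Ordinal hi.
have [asc|desc|/val_inj/perm_inj/(congr1 val) /= /n_Sn//] := ltngtP (s k0) (s k1).
  by rewrite Inv_perm_swap.
by rewrite (Inv_perm_swap_lt desc) ltnW // ltnW.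
Qed.

Lemma Inv_perm1 n : Inv_perm (1 : 'S_n)%g = set0.
Proof.
by apply/setP => ij; rewrite !inE invg1 !perm1; case: ltngtP.
Qed.

Lemma no_descent_perm1 n (s : 'S_n) :
  (forall i (hi : i.+1 < n), s (Ordinal (ltnW hi)) < s (Ordinal hi)) -> s = 1%g.
Proof.
move=> asc; apply/permP => x; rewrite perm1; apply/val_inj/eqP.
rewrite eqn_leq; apply/andP; split.
  have H m (y : 'I_n) : n - y = m.+1 -> s y + m < n.
    elim: m y => [|m IH] y yE; first by rewrite addn0.
    have hy : y.+1 < n by lia.
    have yE' : n - Ordinal hy = m.+1 by rewrite /=; lia.
    have := IH _ yE'; move=> /=.
    have := asc y hy; have -> : Ordinal (ltnW hy) = y by apply: val_inj.
    by lia.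
  have := H (n - x).-1 x; rewrite prednK ?subn_gt0 // => /(_ erefl).
  by have := ltn_ord x; rewrite -[\val x]/(nat_of_ord x) -[\val (s x)]/(nat_of_ord _); lia.
have H m (hm : m < n) : m <= s (Ordinal hm).
  elim: m hm => // m IH hm; apply: leq_ltn_trans (asc m hm); exact: IH.
by have := H x (ltn_ord x); have -> : Ordinal (ltn_ord x) = x by apply: val_inj.
Qed.

Definition rev_perm n : 'S_n := perm (@rev_ord_inj n).

Lemma no_ascent_rev_perm n (s : 'S_n) :
  (forall i (hi : i.+1 < n), s (Ordinal hi) < s (Ordinal (ltnW hi))) ->
  s = rev_perm n.
Proof.
move=> desc; suff : (s * rev_perm n)%g = 1%g.
  move/permP => E; apply/permP => x; have := E x; rewrite permM perm1 permE.
  by move/(congr1 (@rev_ord n)); rewrite rev_ordK permE.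
apply: no_descent_perm1 => i hi; rewrite !permM !permE /=.
have := desc i hi; have := ltn_ord (s (Ordinal (ltnW hi))).
by lia.
Qed.

Lemma Inv_perm_rev n :
  Inv_perm (rev_perm n) = [set ij : 'I_n * 'I_n | ij.1 < ij.2].
Proof.
have revV x : (rev_perm n)^-1%g x = rev_ord x.
  by apply: (canLR (permK _)); rewrite permE rev_ordK.
apply/setP => -[x y]; rewrite !inE !revV /=.
by have := ltn_ord y; have := ltn_ord x; lia.
Qed.

Lemma leq_Inv_perm n (s : 'S_n) : #|Inv_perm s| <= #|Inv_perm (rev_perm n)|.
Proof.
rewrite Inv_perm_rev subset_leq_card //; apply/subsetP => ij.
by rewrite !inE => /andP[].
Qed.

(** * The unique word with increasing labels *)

Lemma e_word_suffix n m : m <= n -> forall x : 'I_n.+1,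
  suffix_prod (e_word n) (n - m) x =
    (if x < n - m then x : nat else if x < n then x.+1 else n - m) :> nat.
Proof.
elim: m => [|m IH] mn x.
  rewrite subn0 /suffix_prod drop_oversize ?size_tuple //= perm1.
  by case: (ltnP x n) (ltn_ord x) => //; lia.
have hj : n - m.+1 < n by lia.
have nm : n - m = (n - m.+1).+1 by lia.
rewrite (suffix_prodS _ (Ordinal hj)) comppE tnth_mktuple /=.
have := IH (ltnW mn) x; rewrite nm.
move: (suffix_prod _ _ x) => y.
case: tpermP => [->|->|/eqP + /eqP +]; rewrite -?val_eqE /= /bump ?leq0n ?add1n.
all: have := ltn_ord x; do ![case: ifP]; lia.
Qed.

Lemma e_word_in_F n : e_word n \in F n.
Proof.
rewrite inE; apply/andP; split.
  apply/allP => _ /tnthP[k ->]; rewrite tnth_mktuple; apply/transpositionP.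
  by do 2!eexists; split; last reflexivity; rewrite /= /bump leq0n.
apply/eqP/permP => x; apply/val_inj => /=.
have := e_word_suffix (leqnn n) x; rewrite subnn /suffix_prod drop0 => ->.
rewrite permE /=; case: ltnP => xn; first by rewrite modn_small.
have -> : x = n :> nat by apply/eqP; rewrite eqn_leq xn -ltnS ltn_ord.
by rewrite modnn.
Qed.

Lemma e_word_suffixE n j (x : 'I_n.+1) : j <= n -> suffix_prod (e_word n) j x =
    (if x < j then x : nat else if x < n then x.+1 else j) :> nat.
Proof. by move=> jn; have := e_word_suffix (leq_subr j n) x; rewrite subKn. Qed.

Lemma phi_e_word n : phi (e_word n) = 1%g.
Proof.
apply/permP => j; rewrite perm1; apply/eqP; rewrite -phiP ?e_word_in_F //.
have jn := ltn_ord j.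
by rewrite /raised !e_word_suffixE //= ?ltnSn ?ltnn ?jn //= ltnW.
Qed.

(** By downward induction the letter labelled j must exchange j and j + 1: it
    raises j, and a point whose image drops to j, never to rise again, can only
    be the largest one, whose image was j + 1. *)
Lemma phi_eq1 n (w : word n) : w \in F n -> phi w = 1%g -> w = e_word n.
Proof.
move=> wF w1; have phE k : phi w k = k by rewrite w1 perm1.
have [eF suf] := (e_word_in_F n, @e_word_suffixE n).
suff H m : m <= n -> suffix_prod w (n - m) = suffix_prod (e_word n) (n - m).
  apply: eq_from_tnth => j; have jn := ltn_ord j.
  have E1 := H (n - j) (leq_subr _ _); have E2 := H (n - j.+1) (leq_subr _ _).
  rewrite !subKn // in E1 E2; last exact: ltnW.
  by move: E1; rewrite !suffix_prodS E2 => /mulgI.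
elim: m => [|m IH] mn.
  by rewrite subn0 /suffix_prod !drop_oversize ?size_tuple.
have hj : n - m.+1 < n by lia.
have nm : n - m = (n - m.+1).+1 by lia.
have {IH} := IH (ltnW mn); rewrite nm; move: hj {nm}.
move: (n - m.+1) => {mn}j hj IH; pose k := Ordinal hj.
rewrite (suffix_prodS w k) (suffix_prodS (e_word n) k) IH; congr compp.
have [a [b [ab tE]]] := transpositionP _ (F_transposition k wF).
have k_at : suffix_prod w j.+1 (widen_ord (leqnSn n) k) = a.
  apply/eqP; rewrite -(tperm_up _ ab) -tE -comppE -(suffix_prodS w k).
  by have := phi_raised k wF; rewrite phE.
have aj : a = j :> nat by rewrite -k_at IH suf //= ltnSn.
pose l := ((suffix_prod w j.+1)^-1)%g b.
have l_at : suffix_prod w j.+1 l = b by rewrite permKV.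
have lE := suf j.+1 l hj; rewrite -IH l_at in lE.
have ln : l = n :> nat.
  apply/eqP; rewrite eqn_leq -ltnS ltn_ord leqNgt; apply/negP => ln.
  have jl : j < l by move: lE; case: (ltnP l j.+1); lia.
  have := @suffix_prod_le n w (Ordinal ln) 0 j wF (ltnW hj).
  have lW : widen_ord (leqnSn n) (Ordinal ln) = l by apply: val_inj.
  have -> : suffix_prod w j (widen_ord (leqnSn n) (Ordinal ln)) = a.
    by rewrite (suffix_prodS w k) comppE lW l_at tE tpermR.
  rewrite suffix_prod_full //= => H.
  suff : l < a by rewrite aj ltnNge ltnW.
  apply: H => k0 k0j; rewrite phE -val_eqE /=; lia.
have bj : b = j.+1 :> nat by move: lE; rewrite ln ltnn ltnNge hj.
rewrite tE tnth_mktuple; congr tperm; apply: val_inj => //=.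
Qed.

(** * Distances in the Hurwitz graph and maximal elements *)

Lemma hurwitz_adj_Inv_le n (u v : word n) : hurwitz_adj u v ->
  #|Inv v| <= #|Inv u|.+1.
Proof.
rewrite /Inv => /hurwitz_adj_phi[->|[i [hi ->]]]; first exact: leqnSn.
exact: Inv_perm_swap_le.
Qed.

Lemma path_Inv_le n (u : word n) p : path (@hurwitz_adj n) u p ->
  #|Inv (last u p)| <= #|Inv u| + size p.
Proof.
elim: p u => [|v p IH] u /=; first by rewrite addn0.
case/andP=> /hurwitz_adj_Inv_le uv /IH/leq_trans; apply.
by rewrite addnS -addSn leq_add2r.
Qed.

(** Sorting the labels by adjacent exchanges, each of them realized by an edge
    of the graph. *)
Lemma path_from_e_word n (w : word n) : w \in F n -> exists p,
  [/\ path (@hurwitz_adj n) (e_word n) p, last (e_word n) p = w &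
      size p = #|Inv w|].
Proof.
have [m] := ubnP #|Inv w|; elim: m w => // m IH w; rewrite ltnS => wm wF.
have [[i [hi desc]]|asc] := pselect (exists i (hi : i.+1 < n),
    phi w (Ordinal hi) < phi w (Ordinal (ltnW hi))); last first.
  have w1 : phi w = 1%g.
    apply: no_descent_perm1 => i hi; rewrite ltn_neqAle leqNgt.
    rewrite (inj_eq val_inj) (inj_eq perm_inj) -val_eqE /= neq_ltn ltnSn /=.
    by apply/negP => desc; apply: asc; exists i, hi.
  exists [::]; rewrite /Inv w1 Inv_perm1 cards0; split=> //.
  by rewrite (phi_eq1 wF w1).
have [v wv phv] := hurwitz_swap hi wF; have := Inv_perm_swap_lt desc.
rewrite /= -phv -/(Inv w) -/(Inv v) => dE.
have vF : v \in F n by case/hurwitz_adjP: wv.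
have [|p [pp lp sp]] := IH v _ vF; first by rewrite -dE.
exists (rcons p w); rewrite rcons_path last_rcons size_rcons pp lp sp dE.
by rewrite hurwitz_adj_sym.
Qed.

(** The word e has no inversion and an edge adds at most one, so a path from e
    to w cannot be shorter than the number of inversions of w. *)
Lemma geodesicP n (w : word n) p : w \in F n ->
  geodesic (e_word n) w p <->
  [/\ path (@hurwitz_adj n) (e_word n) p, last (e_word n) p = w &
      size p = #|Inv w|].
Proof.
move=> wF; have Inv_e : #|Inv (e_word n)| = 0.
  by rewrite /Inv phi_e_word Inv_perm1 cards0.
split=> [[pp lp minp]|[pp lp sp]]; split=> //; last first.
  by move=> q qq lq; have := path_Inv_le qq; rewrite lq Inv_e -sp.
have [q [qq lq sq]] := path_from_e_word wF.
have := minp q qq lq; have := path_Inv_le pp; rewrite lp Inv_e sq.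
by move=> H1 H2; apply/eqP; rewrite eqn_leq H2.
Qed.

(** The distance from e is the number of inversions of the labels, which can be
    increased along an edge as long as the labels have an ascent. *)
Lemma maxFE n (w : word n) :
  (w \in maxF n) = (w \in F n) && (phi w == rev_perm n).
Proof.
rewrite inE; apply: andb_id2l => wF; apply/asboolP/eqP => [wmax|w0 v vF].
  apply: no_ascent_rev_perm => i hi; rewrite ltn_neqAle leqNgt.
  rewrite (inj_eq val_inj) (inj_eq perm_inj) -val_eqE /= neq_ltn ltnSn orbT /=.
  apply/negP => asc; have [v wv phv] := hurwitz_swap hi wF.
  have [_ vF /eqP + _] := hurwitz_adjP _ _ wv; apply.
  apply/esym/wmax => //; have [p [pp lp sp]] := path_from_e_word wF.
  exists (rcons p v); last by rewrite -rcons_cons mem_rcons inE -lp mem_last orbT.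
  apply/geodesicP => //; rewrite rcons_path last_rcons size_rcons pp lp sp wv.
  by split=> //; rewrite /Inv phv Inv_perm_swap.
case=> p /(geodesicP _ vF)[pp lp sp] wp.
case/splitPl: wp pp lp sp => p1 p2 l1.
rewrite cat_path last_cat size_cat l1 => /andP[pp1 pp2] l2 sz.
have p2_nil : size p2 = 0.
  have := path_Inv_le pp1; rewrite l1 {1}/Inv w0 /Inv phi_e_word Inv_perm1 cards0.
  have := leq_Inv_perm (phi v); rewrite -/(Inv v) -sz => /leq_trans H /H{H}.
  by rewrite add0n -[leqRHS]addn0 leq_add2l leqn0 => /eqP.
by move: l2; rewrite (size0nil p2_nil).
Qed.

(** * Cycles along a sequence *)

(** The cycle sending each entry of s to the next, as the product of the
    transpositions of consecutive entries; the default value of head makes the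
    last factor trivial. *)
Fixpoint cyc m (s : seq 'I_m) : 'S_m :=
  if s is x :: s' then compp (tperm x (head x s')) (cyc s') else 1%g.

Lemma perm_onS (T : finType) (A B : {set T}) (u : {perm T}) :
  A \subset B -> perm_on A u -> perm_on B u.
Proof. by move=> AB uA; apply: subset_trans uA AB. Qed.

Lemma perm_on_disjoint_closed (T : finType) (A B : {set T}) (u : {perm T}) x :
  perm_on B u -> [disjoint A & B] -> (u x \in A) = (x \in A).
Proof.
move=> uB AB; have /(perm_closed x) : perm_on (~: A) u.
  by apply: perm_onS uB; rewrite -disjoints_subset disjoint_sym.
by rewrite !inE => /negb_inj.
Qed.

Lemma cyc_on m (s : seq 'I_m) : perm_on [set x in s] (cyc s).
Proof.
elim: s => [|x s IH] /=; first exact: perm_on1.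
apply: perm_onM.
  by apply: perm_onS IH; apply/subsetP => y; rewrite !inE => ->; rewrite orbT.
apply: perm_onS (tperm_on _ _); apply/subsetP => y; rewrite !inE.
case: s {IH} => [|z s] /=; first by rewrite orbb => /eqP->; rewrite eqxx.
by rewrite inE => /orP[]/eqP->; rewrite eqxx ?orbT.
Qed.

Lemma cyc_out m (s : seq 'I_m) x : x \notin s -> cyc s x = x.
Proof. by move=> xs; rewrite (out_perm (cyc_on s)) // inE. Qed.

Lemma cyc_cat m (s1 s2 : seq 'I_m) a :
  cyc (s1 ++ a :: s2) = compp (cyc (rcons s1 a)) (cyc (a :: s2)).
Proof.
elim: s1 => [|x s1 IH] /=; first by rewrite tperm1 /compp !mulg1.
by rewrite IH comppA; case: s1 {IH}.
Qed.

Lemma cyc_rcons m (s : seq 'I_m) y z :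
  cyc (rcons (rcons s y) z) = compp (cyc (rcons s y)) (tperm y z).
Proof. by rewrite -!cats1 -catA /= cyc_cat /= tperm1 /compp !mul1g cats1. Qed.

Lemma cyc_last m (s : seq 'I_m) y : cyc (rcons s y) y = head y s.
Proof.
elim: s => [|x s IH] /=; first by rewrite comppE tperm1 !perm1.
by rewrite comppE IH; case: s {IH} => [|u s] /=; rewrite tpermR.
Qed.

Lemma cyc_map m (s : seq 'I_m) (u : 'S_m) : cyc (map u s) = (cyc s ^ u)%g.
Proof.
elim: s => [|x s IH] /=; first by rewrite conj1g.
by rewrite /compp conjMg -IH tpermJ; case: s {IH}.
Qed.

(** The transposition (y z) that closes the cycle becomes (a z) when moved to the
    left across the cycle along a, ..., y, and conjugation by (a z) replaces a by
    z in the cycle along s1, a. *)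
Lemma cyc_split m (s1 s2 : seq 'I_m) y z :
  uniq (rcons (rcons (s1 ++ s2) y) z) ->
  cyc (rcons (rcons (s1 ++ s2) y) z) =
    compp (tperm (head y s2) z) (compp (cyc (rcons s2 y)) (cyc (rcons s1 z))).
Proof.
set a := head y s2; set t := behead (rcons s2 y).
have E : rcons s2 y = a :: t by rewrite /a /t; case: (s2).
rewrite -[in X in uniq X -> _]cats1 !rcons_cat E -cats1 -catA cat_cons.
rewrite cat_uniq cons_uniq => /and3P[u1 d]; rewrite mem_cat mem_seq1 negb_or.
rewrite -andbA => /and3P[aT az].
rewrite cat_uniq => /and3P[_ zT _];
have {}zT : z \notin t by move: zT; rewrite /= orbF.
have {d} [as1 zs1 dis] : [/\ a \notin s1, z \notin s1 &
    {in s1, forall x, x \notin t}].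
  split; try by apply: contra d => H; apply/hasP; eexists; last exact: H;
    rewrite ?inE ?mem_cat ?mem_seq1 ?eqxx ?orbT.
  move=> x xs; apply: contra d => xt; apply/hasP; exists x => //.
  by rewrite inE mem_cat xt orbT.
rewrite cyc_cat -cat_cons cats1 -E cyc_rcons.
set C := cyc (rcons s2 y).
have Cy : C y = a by exact: cyc_last.
have Cz : C z = z by apply: cyc_out; rewrite E inE negb_or eq_sym az.
have -> : compp C (tperm y z) = compp (tperm a z) C.
  by rewrite /compp conjgC tpermJ Cy Cz.
have -> : rcons s1 a = map (tperm a z) (rcons s1 z).
  rewrite map_rcons tpermR; congr rcons; rewrite -[LHS]map_id.
  apply/eq_in_map => x xs; rewrite tpermD //.
    by apply: contraNneq as1 => ->.
  by apply: contraNneq zs1 => ->.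
rewrite cyc_map /compp conjgE tpermV.
have -> : commute (cyc (rcons s1 z)) C.
  apply: (perm_onC (cyc_on _) (cyc_on _)); rewrite disjoint_subset.
  apply/subsetP => x; rewrite !inE E mem_rcons !inE negb_or.
  case/predU1P=> [->|xs]; first by rewrite eq_sym az.
  by rewrite dis // andbT; apply: contraNneq as1 => <-.
by rewrite -!mulgA; congr mulg; rewrite !mulgA tperm2 mul1g.
Qed.

(** * Minimal products of transpositions *)

Definition norbits m (g : 'S_m) : nat := #|porbits g|.

Lemma norbits_tperm m (g : 'S_m) (x y : 'I_m) : x != y ->
  norbits (compp (tperm x y) g) + (x \notin porbit g y).*2 = (norbits g).+1.
Proof.
move=> xy; rewrite -addn1 -[1]/(nat_of_bool true) -xy /norbits.
rewrite -(porbitsV (compp _ _)) /compp invMg tpermV.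
rewrite -(porbitsV g) -porbits_mul_tperm; congr (_ + (~~ (_ \in _)).*2).
by rewrite porbitV.
Qed.

Lemma norbits1 m : norbits (1 : 'S_m)%g = m.
Proof.
rewrite /norbits card_imset ?card_ord // => x y E.
have : x \in porbit 1%g y by rewrite -E porbit_id.
by case/porbitP => i ->; rewrite expg1n perm1.
Qed.

Lemma leq_norbits_prodp m (w : seq 'S_m) : all (@is_transposition m) w ->
  m <= norbits (prodp w) + size w.
Proof.
elim: w => [|t w IH] /=; first by rewrite addn0 norbits1.
case/andP=> /transpositionP[x [y [xy ->]]] /IH; set g := prodp w.
have xy' : x != y by rewrite -val_eqE neq_ltn /= xy.
by have := norbits_tperm g xy'; case: (_ \notin _) => /=; lia.
Qed.

(** A product of k transpositions of m points has at least m - k orbits; the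
    words reaching this bound are the shortest factorizations. *)
Definition minimal m (w : seq 'S_m) := norbits (prodp w) + size w <= m.

Lemma porbit_closed m (g : 'S_m) (S : {set 'I_m}) x y :
  (forall u, (g u \in S) = (u \in S)) -> x \in porbit g y ->
  (x \in S) = (y \in S).
Proof.
move=> gS /porbitP[i ->]; elim: i => [|i IH]; first by rewrite expg0 perm1.
by rewrite expgSr permM gS.
Qed.

Lemma minimal_cons m (w : seq 'S_m) (x y : 'I_m) : x != y ->
  all (@is_transposition m) w -> minimal (tperm x y :: w) ->
  minimal w /\ x \in porbit (compp (tperm x y) (prodp w)) y.
Proof.
move=> xy trw; rewrite /minimal /=; set h := compp _ _.
have := norbits_tperm h xy.
have -> : compp (tperm x y) h = prodp w by rewrite -comppA /compp tperm2 mulg1.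
have := leq_norbits_prodp trw.
by case: (boolP (x \in _)) => /= _; [split=> // |]; lia.
Qed.

(** In a shortest factorization each letter merges two orbits of the product of
    the letters to its right, so orbits only grow, and every letter preserves
    each union of orbits of the whole product. *)
Lemma minimal_closed m (w : seq 'S_m) (S : {set 'I_m}) :
  all (@is_transposition m) w -> minimal w ->
  (forall x, (prodp w x \in S) = (x \in S)) ->
  {in w, forall t : 'S_m, forall x, (t x \in S) = (x \in S)}.
Proof.
elim: w => // t w IH /andP[/transpositionP[x [y [xy tE]]] trw].
have {}xy : x != y by rewrite -val_eqE neq_ltn /= xy.
rewrite tE => /(minimal_cons xy trw)[mw xyo] hS.
have tS z : (tperm x y z \in S) = (z \in S).
  have xyS := porbit_closed hS xyo.
  by case: tpermP => [->|->|//]; rewrite xyS.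
move=> t'; rewrite inE => /predU1P[->//|t'w]; apply: (IH trw mw) t'w => z.
by rewrite -tS -comppE hS.
Qed.

Lemma minimal_fixed m (w : seq 'S_m) t x :
  all (@is_transposition m) w -> minimal w -> t \in w ->
  prodp w x = x -> t x = x.
Proof.
move=> tw mw tin fx; have := @minimal_closed _ _ [set x] tw mw _ t tin x.
rewrite !inE eqxx => H; apply/eqP/H => y.
by rewrite !inE -{1}fx (inj_eq perm_inj).
Qed.

Lemma norbits_cyc m x (s : seq 'I_m) : uniq (x :: s) ->
  norbits (cyc (x :: s)) + size s = m.
Proof.
elim: s x => [|y s IH] x; first by rewrite /= tperm1 /compp mulg1 norbits1 addn0.
rewrite cons_uniq => /andP[xs us]; have := IH y us.
have -> : cyc [:: x, y & s] = compp (tperm x y) (cyc (y :: s)) by [].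
have xy : x != y by apply: contraNneq xs => ->; rewrite inE eqxx.
have := norbits_tperm (cyc (y :: s)) xy.
have -> : x \notin porbit (cyc (y :: s)) y.
  apply: contra xy => H; have := @porbit_closed _ _ [set x] _ _ _ H.
  rewrite !inE eqxx eq_sym => <- // u; rewrite !inE.
  by rewrite -{1}(cyc_out xs) (inj_eq perm_inj).
by rewrite /=; lia.
Qed.

(** * Words with decreasing labels *)

Fixpoint raises m (r : seq 'I_m) (w : seq 'S_m) : bool :=
  match r, w with
  | [::], [::] => true
  | i :: r', t :: w' => (prodp w' i < t (prodp w' i)) && raises r' w'
  | _, _ => false
  end.

Lemma raises_size m (r : seq 'I_m) w : raises r w -> size w = size r.
Proof. by elim: r w => [|i r IH] [|t w] //= /andP[_ /IH->]. Qed.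

(** A block of letters raises the same points with or without the letters to its
    right, as long as these fix the points in question. *)
Lemma raises_cat m (r1 r2 : seq 'I_m) w1 w2 : size w2 = size r2 ->
  {in r2, prodp w1 =1 id} ->
  raises (r2 ++ r1) (w2 ++ w1) = raises r2 w2 && raises r1 w1.
Proof.
elim: r2 w2 => [|i r2 IH] [|t w2] //= [sz] fx.
rewrite prodp_cat comppE fx ?inE ?eqxx // IH ?andbA // => x xr.
by rewrite fx // inE xr orbT.
Qed.

Lemma raises_catr m (r1 r2 : seq 'I_m) w1 w2 : size w2 = size r2 ->
  raises (r2 ++ r1) (w2 ++ w1) -> raises r1 w1.
Proof. by elim: r2 w2 => [|i r2 IH] [|t w2] //= [sz] /andP[_ /IH]; apply. Qed.

Lemma prodp_closed m (A : {set 'I_m}) (w : seq 'S_m) :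
  {in w, forall t : 'S_m, forall x, (t x \in A) = (x \in A)} ->
  forall x, (prodp w x \in A) = (x \in A).
Proof.
elim: w => [|t w IH] H x /=; first by rewrite perm1.
rewrite comppE H ?inE ?eqxx // IH // => t' t'w; apply: H.
by rewrite inE t'w orbT.
Qed.

Lemma prodp_on m (A : {set 'I_m}) (w : seq 'S_m) :
  {in w, forall t : 'S_m, perm_on A t} -> perm_on A (prodp w).
Proof.
elim: w => [|t w IH] H /=; first exact: perm_on1.
apply: perm_onM; last by apply: H; rewrite inE eqxx.
by apply: IH => t' t'w; apply: H; rewrite inE t'w orbT.
Qed.

(** The lower endpoint of a letter is the image of the point it raises under
    letters that preserve A, and the upper endpoint is the image of the lower
    one under the letter. *)
Lemma raises_on m (A : {set 'I_m}) (r : seq 'I_m) (w : seq 'S_m) :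
  raises r w -> all (@is_transposition m) w -> {subset r <= A} ->
  {in w, forall t : 'S_m, forall x, (t x \in A) = (x \in A)} ->
  {in w, forall t : 'S_m, perm_on A t}.
Proof.
elim: r w => [|i r IH] [|t w] //= /andP[rt rw] /andP[tt tw] rA clo.
have clo' : {in w, forall t : 'S_m, forall x, (t x \in A) = (x \in A)}.
  by move=> t' t'w; apply: clo; rewrite inE t'w orbT.
move=> t'; rewrite inE => /predU1P[->{t'}|]; last first.
  by apply: IH => // x xr; apply: rA; rewrite inE xr orbT.
have [p [q [pq tE]]] := transpositionP _ tt.
have pA : p \in A.
  move: rt; rewrite tE tperm_up // => /eqP<-.
  by rewrite prodp_closed // rA // inE eqxx.
have qA : q \in A by rewrite -(tpermL p q) -tE clo ?inE ?eqxx.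
rewrite tE; apply: perm_onS (tperm_on p q); apply/subsetP => x.
by rewrite !inE => /orP[]/eqP->.
Qed.

Lemma prod_disjoint_inj m (A B : {set 'I_m}) (u u' v v' : 'S_m) :
  [disjoint A & B] -> perm_on A v -> perm_on A v' -> perm_on B u ->
  perm_on B u' -> compp u v = compp u' v' -> u = u' /\ v = v'.
Proof.
move=> dAB vA v'A uB u'B E.
suff vv : v = v' by split=> //; apply: (mulgI v); rewrite {2}vv; exact: E.
apply/permP => x; case: (boolP (x \in A)) => xA; last first.
  by rewrite (out_perm vA) // (out_perm v'A).
have nB y : y \in A -> y \notin B by move=> yA; rewrite (disjointFr dAB).
move/permP/(_ x): E; rewrite !comppE (out_perm uB) ?nB ?perm_closed //.
by rewrite (out_perm u'B) ?nB ?perm_closed.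
Qed.

Definition incr m (s : seq 'I_m) := pairwise (fun i j : 'I_m => i < j) s.

Lemma incr_uniq m (s : seq 'I_m) : incr s -> uniq s.
Proof.
elim: s => //= x s IH /andP[/allP xs /IH->]; rewrite andbT.
by apply/negP => /xs; rewrite ltnn.
Qed.

(** All points of s but the last are raised; they are listed in reverse because
    the rightmost letter acts first. *)
Definition falls m (s : seq 'I_m) (w : seq 'S_m) : bool :=
  [&& all (@is_transposition m) w, prodp w == cyc s & raises (behead (rev s)) w].

Lemma behead_rev_rcons m (s : seq 'I_m) z : behead (rev (rcons s z)) = rev s.
Proof. by rewrite rev_rcons. Qed.

Lemma head_rcons_mem m (s : seq 'I_m) y : head y s \in rcons s y.
Proof. by case: s => [|x s] /=; rewrite inE eqxx. Qed.

Lemma falls_minimal m (s : seq 'I_m) w : uniq s -> s != [::] ->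
  falls s w -> minimal w.
Proof.
case: s => // x s u _ /and3P[_ /eqP pw /raises_size].
rewrite size_behead size_rev /= => sz.
by rewrite /minimal pw sz (norbits_cyc u).
Qed.

Lemma falls_join m (s1 s2 : seq 'I_m) y z w1 w2 :
  incr (rcons (rcons (s1 ++ s2) y) z) ->
  falls (rcons s2 y) w2 -> falls (rcons s1 z) w1 ->
  falls (rcons (rcons (s1 ++ s2) y) z) (tperm (head y s2) z :: w2 ++ w1).
Proof.
move=> inc /and3P[t2 /eqP p2 r2] /and3P[t1 /eqP p1 r1].
have u := incr_uniq inc.
have az : head y s2 < z.
  move: inc; rewrite /incr pairwise_rcons => /andP[/allP + _]; apply.
  by rewrite rcons_cat mem_cat head_rcons_mem orbT.
have out : {in rcons s2 y, prodp w1 =1 id}.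
  move=> x xs; rewrite p1 cyc_out // mem_rcons inE negb_or.
  move: u; rewrite rcons_uniq !rcons_cat cat_uniq mem_cat negb_or.
  case/andP=> /andP[_ zs] /and3P[_ /hasPn/(_ _ xs) ->_]; rewrite andbT.
  by apply: contraNneq zs => <-.
rewrite !behead_rev_rcons in r1 r2; apply/and3P; split.
- rewrite /= all_cat t2 t1 andbT; apply/andP; split=> //.
  by apply/transpositionP; exists (head y s2), z.
- by rewrite cyc_split //= prodp_cat p1 p2.
rewrite behead_rev_rcons rev_rcons rev_cat /= prodp_cat comppE out; last first.
  by rewrite mem_rcons inE eqxx.
rewrite p2 cyc_last tpermL az raises_cat ?r2 ?r1 //; first by rewrite (raises_size r2).
by move=> x; rewrite mem_rev => xs; apply: out; rewrite mem_rcons inE xs orbT.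
Qed.

(** The leftmost letter, which acts last, raises y to its image z under the
    cycle, so it is (p z) for some p, and p lies on the cycle because letters of
    shortest factorizations fix the fixed points of the product.  Removing it
    cuts the cycle into two.  The other letters preserve both supports, so each
    is supported in the part that contains the point it raises. *)
Lemma falls_cut m (s : seq 'I_m) y z w :
  incr (rcons (rcons s y) z) -> falls (rcons (rcons s y) z) w ->
  exists s1 s2 w1 w2, [/\ s = s1 ++ s2, w = tperm (head y s2) z :: w2 ++ w1,
    falls (rcons s2 y) w2 & falls (rcons s1 z) w1].
Proof.
move=> inc fw; have u := incr_uniq inc.
have mw : minimal w by apply: falls_minimal fw => //; case: (s).
move: fw => /and3P[tw /eqP pw]; rewrite behead_rev_rcons rev_rcons.
have yz : y != z.
  move: u; rewrite rcons_uniq mem_rcons inE negb_or eq_sym.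
  by case/andP=> /andP[].
move: tw pw mw; case: w => [|t w] //= /andP[tt tw] pw mw /andP[rt rw].
have allt : all (@is_transposition m) (t :: w) by rewrite /= tt.
have [p [r [pr tE]]] := transpositionP _ tt.
have py : prodp w y = p by apply/eqP; rewrite -(tperm_up _ pr) -tE.
have rz : r = z.
  rewrite -(tpermL p r) -tE -py -comppE pw cyc_rcons comppE tpermL cyc_out //.
  by move: u; rewrite rcons_uniq => /andP[].
rewrite {}rz in pr tE.
have tp : t p = z by rewrite tE tpermL.
have pz : p != z by rewrite -val_eqE neq_ltn /= pr.
have ps : p \in rcons s y.
  have : p \in rcons (rcons s y) z.
    apply: contraNT pz => /cyc_out pn; rewrite -tp eq_sym; apply/eqP.
    by apply: (minimal_fixed allt mw); rewrite ?inE ?eqxx //= pw.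
  by rewrite mem_rcons inE (negPf pz).
have [s1 [s2 [sE hE]]] : exists s1 s2, s = s1 ++ s2 /\ head y s2 = p.
  move: ps; rewrite mem_rcons inE => /predU1P[->|/splitPr[s1 s2]].
    by exists s, [::]; rewrite cats0.
  by exists s1, (p :: s2).
rewrite {s}sE in inc pw rw ps u *.
have gE : prodp w = compp (cyc (rcons s2 y)) (cyc (rcons s1 z)).
  apply: (mulIg t); rewrite -/(compp t (prodp w)) pw cyc_split // hE tE //.
set A := [set x in rcons s1 z]; set B := [set x in rcons s2 y].
have dAB : [disjoint A & B].
  rewrite disjoint_subset; apply/subsetP => x; rewrite !inE mem_rcons inE => xA.
  move: u; rewrite rcons_uniq !rcons_cat cat_uniq mem_cat negb_or.
  case/andP=> /andP[_ zs] /and3P[_ /hasPn dis _].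
  by case/predU1P: xA => [->//|xs]; apply/negP => /dis; rewrite /= xs.
have gA x : (prodp w x \in A) = (x \in A).
  by rewrite gE comppE (perm_on_disjoint_closed _ (cyc_on _) dAB) perm_closed ?cyc_on.
have gB x : (prodp w x \in B) = (x \in B).
  rewrite disjoint_sym in dAB.
  by rewrite gE comppE perm_closed ?cyc_on // (perm_on_disjoint_closed _ (cyc_on _) dAB).
have := mw; rewrite tE => /(minimal_cons pz tw)[mw' _].
pose w2 := take (size s2) w; pose w1 := drop (size s2) w.
have wE : w = w2 ++ w1 by rewrite cat_take_drop.
have sz : size w = size s2 + size s1.
  by rewrite (raises_size rw) size_rev size_cat addnC.
have sz2 : size w2 = size (rev s2).
  by rewrite size_rev size_takel // sz leq_addr.
exists s1, s2, w1, w2; rewrite hE -wE -tE.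
have cloA := minimal_closed tw mw' gA; have cloB := minimal_closed tw mw' gB.
have [in1 in2] : {subset w1 <= w} /\ {subset w2 <= w}.
  by rewrite wE; split=> x xw; rewrite mem_cat xw ?orbT.
move: (tw); rewrite {1}wE all_cat => /andP[tw2 tw1].
rewrite wE rev_cat in rw; have r1 := raises_catr sz2 rw.
have w1A : {in w1, forall t : 'S_m, perm_on A t}.
  apply: (raises_on r1) => // [x|t' /in1]; last exact: cloA.
  by rewrite mem_rev !inE mem_rcons inE => ->; rewrite orbT.
have p1A := prodp_on w1A.
have fix2 : {in rev s2, prodp w1 =1 id}.
  move=> x; rewrite mem_rev => xs; apply: (out_perm p1A).
  by rewrite (disjointFl dAB) // inE mem_rcons inE xs orbT.
rewrite raises_cat // in rw; case/andP: rw => r2 _.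
have w2B : {in w2, forall t : 'S_m, perm_on B t}.
  apply: (raises_on r2) => // [x|t' /in2]; last exact: cloB.
  by rewrite mem_rev !inE mem_rcons inE => ->; rewrite orbT.
have [p2E p1E] : prodp w2 = cyc (rcons s2 y) /\ prodp w1 = cyc (rcons s1 z).
  apply: (prod_disjoint_inj dAB) => //; try exact: cyc_on; first exact: prodp_on.
  by rewrite -prodp_cat -wE.
by split=> //; apply/and3P; rewrite behead_rev_rcons ?p1E ?p2E.
Qed.

(** * The list of falling words *)

Lemma incr_split m (s1 s2 : seq 'I_m) y z :
  incr (rcons (rcons (s1 ++ s2) y) z) ->
  incr (rcons s2 y) /\ incr (rcons s1 z).
Proof.
rewrite /incr !pairwise_rcons pairwise_cat all_rcons !all_cat.
by case/andP=> /and3P[_ -> _] /andP[/andP[_ ->] /and3P[_ -> ->]].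
Qed.

Lemma incr_take_drop m (s : seq 'I_m) y z j :
  incr (rcons (rcons s y) z) ->
  incr (rcons (drop j s) y) /\ incr (rcons (take j s) z).
Proof. by move=> inc; apply: incr_split; rewrite cat_take_drop. Qed.

Lemma falls_size m (s : seq 'I_m) z w : falls (rcons s z) w -> size w = size s.
Proof. by case/and3P=> _ _ /raises_size; rewrite behead_rev_rcons size_rev. Qed.

Lemma falls1 m (z : 'I_m) w : falls [:: z] w = (w == [::]).
Proof.
apply/idP/eqP => [/(@falls_size _ [::])/size0nil //|->].
by rewrite /falls /= tperm1 /compp mulg1 eqxx.
Qed.

(** A list of the words that fall along rcons s z, by the decomposition of
    falls_cut with j points in s1; the recursion is not structural, so k bounds
    its depth. *)
Fixpoint fall_words m k (s : seq 'I_m) (z : 'I_m) : seq (seq 'S_m) :=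
  if k is k'.+1 then
    if s is x :: s' then
      let s0 := belast x s' in let y := last x s' in
      [seq tperm (head y (drop j s0)) z :: w | j <- iota 0 (size s0).+1,
         w <- [seq w2 ++ w1 | w2 <- fall_words k' (drop j s0) y,
                              w1 <- fall_words k' (take j s0) z]]
    else [:: [::]]
  else [:: [::]].

Lemma fall_wordsP m k (s : seq 'I_m) z w : size s <= k -> incr (rcons s z) ->
  (w \in fall_words k s z) = falls (rcons s z) w.
Proof.
elim: k s z w => [|k IH] s z w.
  by rewrite leqn0 => /nilP-> _; rewrite falls1 /= inE.
case: s => [|x s'] ; first by rewrite falls1 /= inE.
cbn [fall_words]; rewrite lastI size_rcons ltnS.
move: (belast x s') (last x s') => s0 y sk inc.
have split_inc j := incr_take_drop j inc.
have szs j : size (drop j s0) <= k /\ size (take j s0) <= k.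
  rewrite size_drop size_take_min; split; last exact: leq_trans (geq_minr _ _) sk.
  exact: leq_trans (leq_subr _ _) sk.
apply/allpairsPdep/idP => [[j [u [js /allpairsPdep[w2 [w1 [w2i w1i ->]]] ->]]]|fw].
  have [i2 i1] := split_inc j; have [k2 k1] := szs j.
  rewrite !IH // in w2i w1i; have := @falls_join _ (take j s0) (drop j s0) y z w1 w2.
  by rewrite cat_take_drop; apply.
have [s1 [s2 [w1 [w2 [sE wE f2 f1]]]]] := falls_cut inc fw.
have dE : drop (size s1) s0 = s2 by rewrite sE drop_size_cat.
have tE : take (size s1) s0 = s1 by rewrite sE take_size_cat.
exists (size s1), (w2 ++ w1); rewrite dE tE mem_iota add0n ltnS leq0n; split=> //.
  by rewrite sE size_cat leq_addr.
have [i2 i1] := split_inc (size s1); have [k2 k1] := szs (size s1).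
rewrite dE tE in i2 i1 k2 k1.
by apply/allpairsPdep; exists w2, w1; rewrite !IH.
Qed.

Lemma fall_words_size m k (s : seq 'I_m) z w : size s <= k ->
  incr (rcons s z) -> w \in fall_words k s z -> size w = size s.
Proof. by move=> sk inc; rewrite fall_wordsP //; apply: falls_size. Qed.

Lemma fall_words_uniq m k (s : seq 'I_m) z : size s <= k ->
  incr (rcons s z) -> uniq (fall_words k s z).
Proof.
elim: k s z => [|k IH] s z //.
case: s => [|x s'] //.
cbn [fall_words]; rewrite lastI size_rcons ltnS.
move: (belast x s') (last x s') => s0 y sk inc.
have split_inc j := incr_take_drop j inc.
have szs j : size (drop j s0) <= k /\ size (take j s0) <= k.
  rewrite size_drop size_take_min; split; last exact: leq_trans (geq_minr _ _) sk.
  exact: leq_trans (leq_subr _ _) sk.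
have hnth j : head y (drop j s0) = nth y (rcons s0 y) j.
  rewrite -nth0 nth_drop addn0 nth_rcons; case: ltnP => // H.
  by rewrite nth_default //; case: eqP.
have hz j : head y (drop j s0) < z.
  move: inc; rewrite /incr pairwise_rcons => /andP[/allP + _]; apply.
  have := head_rcons_mem (drop j s0) y; rewrite !mem_rcons !inE.
  by case/predU1P=> [->|/mem_drop->]; rewrite ?eqxx ?orbT.
apply: allpairs_uniq_dep; first exact: iota_uniq.
  move=> j _; have [i2 i1] := split_inc j; have [k2 k1] := szs j.
  apply: allpairs_uniq; try exact: IH.
  move=> _ _ /allpairsP[[w2 w1] [/= w2i w1i ->]] /allpairsP[[v2 v1] [/= v2i v1i ->]] /=.
  move/eqP; rewrite eqseq_cat; first by case/andP=> /eqP-> /eqP->.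
  by rewrite (fall_words_size k2 i2 w2i) (fall_words_size k2 i2 v2i).
move=> p1 p2 /allpairsPdep[j [w [js wi ->]]] /allpairsPdep[j' [w' [js' wi' ->]]] /=.
move=> [/eqP + ->]; rewrite tperm_lt_eq // eqxx andbT !hnth.
rewrite nth_uniq ?size_rcons; first by move/eqP->.
- by move: js; rewrite mem_iota.
- by move: js'; rewrite mem_iota.
by have := incr_uniq inc; rewrite rcons_uniq => /andP[].
Qed.

(** * Kinds of pairs of letters *)

(** In terms of the intervals of the two letters, the two shapes of right (or
    left) pairs are the case of a common end and the case of strict nesting, and
    merge into one condition with a weak inequality. *)
Lemma right_pairE m (p q u v : 'I_m) : p < q -> u < v ->
  right_pair (tperm p q) (tperm u v) = (p <= u) && (v < q).
Proof.
move=> pq uv; apply/idP/andP => [|[pu vq]].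
  case/orP=> /existsP[a /existsP[b /existsP[c]]].
    case/and3P=> /andP[ab bc]; rewrite !tperm_lt_eq //; last exact: ltn_trans bc.
    by move=> /andP[/eqP-> /eqP->] /andP[/eqP-> /eqP->].
  case/existsP=> d /and4P[/andP[ab bc] cd].
  have ad : a < d by apply: ltn_trans cd; apply: ltn_trans bc.
  by rewrite !tperm_lt_eq // => /andP[/eqP-> /eqP->] /andP[/eqP-> /eqP->]; rewrite ltnW.
move: pu; rewrite leq_eqVlt => /orP[/eqP/val_inj E|pu]; apply/orP.
  rewrite -{u}E in uv *; left; apply/existsP; exists p.
  apply/existsP; exists v; apply/existsP; exists q.
  by rewrite uv vq !eqxx.
right; apply/existsP; exists p; apply/existsP; exists u; apply/existsP; exists v.
by apply/existsP; exists q; rewrite pu uv vq !eqxx.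
Qed.

Lemma left_pairE m (p q u v : 'I_m) : p < q -> u < v ->
  left_pair (tperm p q) (tperm u v) = (u < p) && (q <= v).
Proof.
move=> pq uv; apply/idP/andP => [|[up]].
  case/orP=> /existsP[a /existsP[b /existsP[c]]].
    case/and3P=> /andP[ab bc]; rewrite !tperm_lt_eq //; last exact: ltn_trans bc.
    by move=> /andP[/eqP-> /eqP->] /andP[/eqP-> /eqP->].
  case/existsP=> d /and4P[/andP[ab bc] cd].
  have ad : a < d by apply: ltn_trans cd; apply: ltn_trans bc.
  rewrite !tperm_lt_eq // => /andP[/eqP-> /eqP->] /andP[/eqP-> /eqP->].
  by split=> //; apply: ltnW.
rewrite leq_eqVlt => /orP[/eqP/val_inj E|qv]; apply/orP.
  rewrite -{v}E in uv *; left; apply/existsP; exists u.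
  apply/existsP; exists p; apply/existsP; exists q.
  by rewrite up pq !eqxx.
right; apply/existsP; exists u; apply/existsP; exists p; apply/existsP; exists q.
by apply/existsP; exists v; rewrite up pq qv !eqxx.
Qed.

Lemma neutral_pairE m (p q u v : 'I_m) : p < q -> u < v ->
  neutral_pair (tperm p q) (tperm u v) = (v < p).
Proof.
move=> pq uv; apply/idP/idP => [|vp].
  case/existsP=> a /existsP[b /existsP[c /existsP[d]]].
  case/and4P=> /andP[ab bc] cd.
  by rewrite !tperm_lt_eq // => /andP[/eqP-> _] /andP[_ /eqP->].
apply/existsP; exists u; apply/existsP; exists v; apply/existsP; exists p.
by apply/existsP; exists q; rewrite uv vp pq !eqxx.
Qed.

Definition LN_pair m : rel 'S_m := [rel x y | left_pair x y || neutral_pair x y].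

Lemma falls_letter m (s : seq 'I_m) w t : incr s -> s != [::] -> falls s w ->
  t \in w -> exists p q, [/\ p \in s, q \in s, p < q & t = tperm p q].
Proof.
move=> inc sn fw tw; have mw := falls_minimal (incr_uniq inc) sn fw.
have /and3P[trw /eqP pw _] := fw.
have [p [q [pq tE]]] := transpositionP _ (allP trw _ tw).
have moved x : t x != x -> x \in s.
  apply: contraNT => /cyc_out xs; apply/eqP.
  by apply: (minimal_fixed trw mw tw); rewrite pw.
by exists p, q; split=> //; apply: moved; rewrite tE ?tpermL ?tpermR -val_eqE
  neq_ltn pq ?orbT.
Qed.

(** All letters of w2 lie between a and z, and avoid z.  A letter of w1 begins to
    the left of a, and it ends either there or at z, beyond which no letter
    reaches. *)
Lemma falls_cross m (s1 s2 : seq 'I_m) y z w1 w2 :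
  incr (rcons (rcons (s1 ++ s2) y) z) ->
  falls (rcons s2 y) w2 -> falls (rcons s1 z) w1 ->
  let t := tperm (head y s2) z in
  {in w2, forall u, right_pair t u && ~~ LN_pair t u} /\
  {in t :: w2 & w1, forall u v, ~~ right_pair u v && LN_pair u v}.
Proof.
move=> inc f2 f1; have [inc2 inc1] := incr_split inc.
set a := head y s2 => t; set T := rcons s2 y.
have aT : {in T, forall p : 'I_m, a <= p}.
  rewrite /a /T in inc2 *; case: (s2) inc2 => [|b s] /=.
    by move=> _ p; rewrite inE => /eqP->.
  by case/andP=> /allP H _ p; rewrite inE => /predU1P[->//|/H/ltnW].
have [s1T Tz] : {in s1 & T, forall p q : 'I_m, p < q} /\ {in T, forall p : 'I_m, p < z}.
  move: inc; rewrite /incr pairwise_rcons rcons_cat pairwise_cat all_cat.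
  case/andP=> /andP[_ /allP H] /and3P[/allrelP H' _ _]; split=> //.
have az : a < z by apply: Tz; apply: head_rcons_mem.
have nn (s : seq 'I_m) x : rcons s x != [::] by case: s.
have pair (p q u v : 'I_m) : p < q -> u < v ->
    LN_pair (tperm p q) (tperm u v) = (u < p) && (q <= v) || (v < p).
  by move=> pq uv; rewrite /LN_pair /= left_pairE ?neutral_pairE.
split=> [u /(falls_letter inc2 (nn _ _) f2)[p [q [pT qT pq ->]]]|u v].
  rewrite pair // right_pairE // (aT _ pT) (Tz _ qT) /=.
  by have := aT _ pT; lia.
move=> uin /(falls_letter inc1 (nn _ _) f1)[p' [q' [pS qS pq' ->]]].
have [p [q [pT qz pq ->]]] : exists p q : 'I_m, [/\ p \in T, q <= z, p < q & u = tperm p q].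
  move: uin; rewrite inE => /predU1P[->|].
    by exists a, z; split=> //; apply: head_rcons_mem.
  case/(falls_letter inc2 (nn _ _) f2)=> p [q [pT qT pq ->]].
  by exists p, q; split=> //; apply/ltnW/Tz.
rewrite pair // right_pairE //.
have p's : p' \in s1.
  move: pS qS; rewrite !mem_rcons !inE => /predU1P[pE|//] /predU1P[qE|qs].
    by move: pq'; rewrite pE qE ltnn.
  have := s1T q' a qs (head_rcons_mem _ _); move: pq' az; rewrite pE; lia.
have := s1T _ _ p's pT; move: qS; rewrite mem_rcons inE => /predU1P[->|qs]; first lia.
by have := s1T _ _ qs pT; lia.
Qed.

Lemma falls_ind m (P : seq 'I_m -> seq 'S_m -> Prop) :
  (forall z, P [:: z] [::]) ->
  (forall s1 s2 y z w1 w2, incr (rcons (rcons (s1 ++ s2) y) z) ->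
     falls (rcons s2 y) w2 -> falls (rcons s1 z) w1 ->
     P (rcons s2 y) w2 -> P (rcons s1 z) w1 ->
     P (rcons (rcons (s1 ++ s2) y) z) (tperm (head y s2) z :: w2 ++ w1)) ->
  forall s z w, incr (rcons s z) -> falls (rcons s z) w -> P (rcons s z) w.
Proof.
move=> P1 PS s; have [k] := ubnP (size s); elim: k s => // k IH s + z w.
case/lastP: s => [|s y] sk inc fw; first by move: fw; rewrite /= falls1 => /eqP->.
have [s1 [s2 [w1 [w2 [sE -> f2 f1]]]]] := falls_cut inc fw.
rewrite size_rcons ltnS in sk; rewrite sE in inc sk *.
have [inc2 inc1] := incr_split inc.
by apply: PS => //; apply: IH => //; apply: leq_ltn_trans sk;
  rewrite size_cat ?leq_addl ?leq_addr.
Qed.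

(** * Counting pairs *)

Fixpoint npairs T (r : rel T) (s : seq T) : nat :=
  if s is x :: s' then count (r x) s' + npairs r s' else 0.

Lemma npairs_cat (T : eqType) (r : rel T) s1 s2 :
  {in s1 & s2, forall x y, r x y} ->
  npairs r (s1 ++ s2) = npairs r s1 + npairs r s2 + size s1 * size s2.
Proof.
elim: s1 => [|x s1 IH] H /=; first by rewrite mul0n addn0.
rewrite IH => [|u v us vs]; last by rewrite H // inE us orbT.
rewrite count_cat; have -> : count (r x) s2 = size s2.
  by apply/eqP; rewrite -all_count; apply/allP => y ys; rewrite H // inE eqxx.
by rewrite mulSn; lia.
Qed.

Lemma npairs_falls m (s1 s2 : seq 'I_m) y z w1 w2 :
  incr (rcons (rcons (s1 ++ s2) y) z) ->
  falls (rcons s2 y) w2 -> falls (rcons s1 z) w1 ->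
  npairs (@LN_pair m) (tperm (head y s2) z :: w2 ++ w1) =
    npairs (@LN_pair m) w2 + npairs (@LN_pair m) w1 + (size w2).+1 * size w1.
Proof.
move=> inc f2 f1; have [H1 H2] := falls_cross inc f2 f1.
rewrite -cat_cons npairs_cat /=; last by move=> u v uw vw; case/andP: (H2 u v uw vw).
suff -> : count (LN_pair (tperm (head y s2) z)) w2 = 0 by [].
apply/eqP; rewrite -leqn0 leqNgt -has_count; apply/hasPn => u uw.
by case/andP: (H1 u uw).
Qed.

Lemma falls_kinds m (s : seq 'I_m) z w : incr (rcons s z) -> falls (rcons s z) w ->
  pairwise (fun u v => right_pair u v == ~~ LN_pair u v) w.
Proof.
apply: (@falls_ind m (fun _ w => pairwise _ w)) => // s1 s2 y z' w1 w2 inc f2 f1 k2 k1.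
have [H1 H2] := falls_cross inc f2 f1.
rewrite -cat_cons pairwise_cat /= k2 k1 !andbT; apply/andP; split.
  by apply/allrelP => u v uw vw; case/andP: (H2 u v uw vw) => /negPf-> ->.
by apply/allP => u uw; case/andP: (H1 u uw) => -> /negPf->.
Qed.

Lemma npairs_compl T (r r' : rel T) s : pairwise (fun x y => r x y == ~~ r' x y) s ->
  npairs r s + npairs r' s = 'C(size s, 2).
Proof.
elim: s => //= x s IH /andP[xs /IH E]; rewrite binS bin1 -E.
suff : count (r x) s + count (r' x) s = size s by lia.
rewrite -(count_predC (r' x) s) addnC; congr (_ + _).
by elim: s xs {IH E} => //= y s IH /andP[/eqP-> /IH->].
Qed.

Lemma npairs_sum T x0 (r : rel T) s :
  npairs r s = \sum_(k < size s) \sum_(l < size s)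
    ((k < l) && r (nth x0 s k) (nth x0 s l)).
Proof.
elim: s => [|x s IH] /=; first by rewrite big_ord0.
rewrite big_ord_recl big_ord_recl /= add0n; congr (_ + _).
  by rewrite -sum1_count (big_nth x0) big_mkord big_mkcond; apply: eq_bigr => l _;
     case: (r _ _).
by rewrite IH; apply: eq_bigr => k _; rewrite big_ord_recl.
Qed.

(** With j letters in w2 and i in w1, the exponent (j + 1) i of the recursion is
    the number of left or neutral pairs between the parts (npairs_falls). *)
Lemma fall_words_sum m k (s : seq 'I_m) z : size s <= k -> incr (rcons s z) ->
  (\sum_(w <- fall_words k s z) 'X^(npairs (@LN_pair m) w) = carlitz (size s))%R.
Proof.
elim: k s z => [|k IH] s z.
  by rewrite leqn0 => /nilP-> _; rewrite /= big_seq1 expr0 carlitz0.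
case: s => [|x s']; first by rewrite /= big_seq1 expr0 carlitz0.
cbn [fall_words]; rewrite lastI size_rcons ltnS.
move: (belast x s') (last x s') => s0 y sk inc.
have -> : iota 0 (size s0).+1 = index_iota 0 (size s0).+1 by rewrite /index_iota subn0.
rewrite big_allpairs_dep carlitzS big_mkord.
rewrite (reindex_inj rev_ord_inj) /=.
apply: eq_bigr => j _; rewrite subSS.
have js : j <= size s0 by rewrite -ltnS.
set i := size s0 - j; have is0 : i <= size s0 by rewrite leq_subr.
have [inc2 inc1] := incr_take_drop i inc.
have sz1 : size (take i s0) = i by rewrite size_takel.
have sz2 : size (drop i s0) = j by rewrite size_drop subKn.
have [k2 k1] : size (drop i s0) <= k /\ size (take i s0) <= k.
  by rewrite sz1 sz2 !(leq_trans _ sk).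
have := IH _ _ k1 inc1; have := IH _ _ k2 inc2; rewrite sz1 sz2 => <- <-.
rewrite big_allpairs_dep -mulrA mulr_suml mulr_sumr.
rewrite big_seq [RHS]big_seq; apply: eq_bigr => w2 w2i.
rewrite !mulr_sumr big_seq [RHS]big_seq; apply: eq_bigr => w1 w1i.
have := w2i; have := w1i; rewrite !fall_wordsP // => f1 f2.
have := @npairs_falls _ (take i s0) (drop i s0) y z w1 w2.
rewrite cat_take_drop => /(_ inc f2 f1) /= ->.
rewrite (fall_words_size k2 inc2 w2i) (fall_words_size k1 inc1 w1i) sz1 sz2.
by rewrite !exprD mulrC.
Qed.

(** * Falling words and maximal elements *)

Lemma cyc_prodp m x (s : seq 'I_m) :
  cyc (x :: s) = prodp (pairmap (fun y z => tperm y z) x s).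
Proof.
elim: s x => [|y s IH] x; first by rewrite /= tperm1 /compp mulg1.
by rewrite [RHS]/= -IH.
Qed.

(** All points but the last, so that rcons (pts n) ord_max has the shape used for
    falling words. *)
Definition pts n : seq 'I_n.+1 := map (widen_ord (leqnSn n)) (enum 'I_n).

Lemma pts_enum n : rcons (pts n) ord_max = enum 'I_n.+1.
Proof. by rewrite enum_ordSr. Qed.

Lemma size_pts n : size (pts n) = n.
Proof. by rewrite size_map size_enum_ord. Qed.

Lemma incr_pts n : incr (rcons (pts n) ord_max).
Proof.
rewrite pts_enum /incr -(pairwise_map val ltn) val_enum_ord.
by rewrite -sorted_pairwise ?iota_ltn_sorted //; apply: ltn_trans.
Qed.

Lemma cyc_pts n : cyc (rcons (pts n) ord_max) = long_cycle n.
Proof.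
have := e_word_in_F n; rewrite inE => /andP[_ /eqP<-].
rewrite pts_enum enum_ordSl cyc_prodp; congr prodp.
apply: (@eq_from_nth _ 1%g) => [|i].
  by rewrite size_pairmap size_map size_enum_ord size_tuple.
rewrite size_pairmap size_map size_enum_ord => ni.
rewrite (nth_pairmap ord0); last by rewrite size_map size_enum_ord.
have -> : (nth 1%g (e_word n) i) = tnth (e_word n) (Ordinal ni).
  by rewrite (tnth_nth 1%g).
rewrite tnth_mktuple; congr tperm; apply: val_inj => /=.
  case: i ni => //= i ni.
  have lt_in : i < n := ltnW ni.
  by rewrite (nth_map (Ordinal ni)) ?size_enum_ord //= nth_enum_ord.
by rewrite (nth_map (Ordinal ni)) ?size_enum_ord //= nth_enum_ord.
Qed.

Lemma raisesP m x0 (r : seq 'I_m) w : size r = size w ->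
  reflect (forall j, j < size w -> prodp (drop j.+1 w) (nth x0 r j) <
                                   prodp (drop j w) (nth x0 r j))
          (raises r w).
Proof.
elim: r w => [|i r IH] [|t w] //= sz; first by constructor.
have {}sz : size r = size w by case: sz.
apply: (iffP andP) => [[rt /(IH _ sz) H] [|j] jw|H]; first by rewrite drop0 /= comppE.
  exact: H.
split; first by have := H 0 isT; rewrite /= drop0 comppE.
by apply/(IH _ sz) => j jw; apply: (H j.+1).
Qed.

Lemma maxF_falls n (w : word n) :
  (w \in maxF n) = falls (rcons (pts n) ord_max) w.
Proof.
rewrite maxFE /falls cyc_pts inE -andbA.
case: (boolP (prodp w == _)) => wE /=; last by rewrite !andbF.
case: (boolP (all _ _)) => //= tw; have wF : w \in F n by rewrite inE tw.
have sz : size (rev (pts n)) = size w by rewrite size_rev size_pts size_tuple.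
have ptsE (j : 'I_n) : nth ord0 (rev (pts n)) j = widen_ord (leqnSn n) (rev_ord j).
  have lt_jn : n - j.+1 < n by have := ltn_ord j; lia.
  rewrite nth_rev size_pts // (nth_map (rev_ord j)) ?size_enum_ord //.
  by congr widen_ord; apply: val_inj; rewrite /= nth_enum_ord.
rewrite behead_rev_rcons; apply/eqP/(raisesP ord0 sz) => [w0 j|H].
  rewrite size_tuple => jn; have := phi_raised (Ordinal jn) wF.
  by rewrite w0 permE /raised -ptsE.
apply/permP => j; apply/eqP; rewrite permE -phiP // /raised -ptsE.
by apply: H; rewrite size_tuple.
Qed.

Lemma card_pairs n (r : rel 'S_n.+1) (w : word n) :
  npairs r w =
  #|[set kl : 'I_n * 'I_n | (kl.1 < kl.2) && r (tnth w kl.1) (tnth w kl.2)]|.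
Proof.
rewrite (npairs_sum 1%g) size_tuple pair_bigA /= -sum1_card [RHS]big_mkcond /=.
apply: eq_bigr => -[k l] _; rewrite inE /= !(tnth_nth 1%g).
by case: (_ && _).
Qed.

(** For decreasing labels all pairs of labels are inversions, and passing from
    labels to positions reverses the order. *)
Lemma Inv_of_kind_npairs n kind (w : word n) : w \in maxF n ->
  #|Inv_of_kind kind w| = npairs kind w.
Proof.
rewrite maxFE => /andP[wF /eqP w0].
have phV j : (phi w)^-1%g j = rev_ord j.
  by rewrite w0; apply: (canLR (permK _)); rewrite permE rev_ordK.
rewrite card_pairs; pose f (p : 'I_n * 'I_n) := (rev_ord p.2, rev_ord p.1).
have fK : cancel f f by case=> i j; rewrite /f /= !rev_ordK.
rewrite -(card_imset _ (can_inj fK)); apply: eq_card => -[i j].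
rewrite -[(i, j)]fK mem_imset ?fK; last exact: can_inj fK.
rewrite !inE /= !phV /=; congr (_ && _).
by have := ltn_ord i; have := ltn_ord j; lia.
Qed.

Lemma inv_LN_npairs n (w : word n) : w \in maxF n ->
  inv_LN w = npairs (@LN_pair n.+1) w.
Proof.
move=> wm; rewrite -(Inv_of_kind_npairs _ wm) /inv_LN.
suff -> : Inv_of_kind (@LN_pair n.+1) w = Inv_L w :|: Inv_N w by [].
by apply/setP => ij; rewrite in_setU !in_set -andb_orr.
Qed.

Lemma inv_R_LN n (w : word n) : w \in maxF n -> inv_R w + inv_LN w = 'C(n, 2).
Proof.
move=> wm; rewrite inv_LN_npairs // /inv_R Inv_of_kind_npairs //.
rewrite npairs_compl ?size_tuple //.
by apply: falls_kinds (incr_pts n) _; rewrite -maxF_falls.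
Qed.

Local Open Scope ring_scope.

Lemma sum_inv_LN n : \sum_(w in maxF n) 'X^(inv_LN w) = carlitz n.
Proof.
have := fall_words_sum (leqnn _) (incr_pts n); rewrite size_pts => <-.
rewrite (eq_bigr (fun w : word n => 'X^(npairs (@LN_pair n.+1) (val w)))); last first.
  by move=> w wm; rewrite inv_LN_npairs.
rewrite -big_enum -(big_map val xpredT (fun w => 'X^(npairs (@LN_pair n.+1) w))).
apply: perm_big; apply: uniq_perm.
- by rewrite (map_inj_uniq val_inj) enum_uniq.
- by apply: fall_words_uniq; rewrite ?size_pts ?incr_pts.
move=> w; rewrite fall_wordsP ?size_pts ?incr_pts //; apply/mapP/idP => [[u]|fw].
  by rewrite mem_enum maxF_falls => fu ->.
have sz : size w == n by rewrite (falls_size fw) size_pts.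
by exists (Tuple sz); rewrite // mem_enum maxF_falls.
Qed.

Lemma sum_inv_R n (K : fieldType) (q : K) : q != 0 ->
  \sum_(w in maxF n) q ^+ inv_R w =
    q ^+ 'C(n, 2) * (map_poly intr (carlitz n)).[q^-1].
Proof.
move=> q0; rewrite -sum_inv_LN rmorph_sum horner_sum mulr_sumr.
apply: eq_bigr => w wm; rewrite /= map_polyXn hornerXn -(inv_R_LN wm).
by rewrite exprD exprVn mulfK // expf_neq0.
Qed.

(* The first identity involves q^{-1}; it is stated in the fraction field of
   Z[q]. *)
Theorem corollary9p5 (n : nat) (hn : (0 < n)%N) :
  (let q : {fraction {poly int}} := tofrac 'X in
   \sum_(w in maxF n) q ^+ inv_R w =
     q ^+ 'C(n, 2) * (map_poly intr (carlitz n)).[q^-1])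
  /\ \sum_(w in maxF n) 'X^(inv_LN w) = carlitz n.
Proof.
split; last exact: sum_inv_LN.
by move=> q; apply: sum_inv_R; rewrite tofrac_eq0 polyX_eq0.
Qed.
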